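(* Let $K^*\in\mathcal{K}$ denote the global optimum of $\min_{K\in\mathcal{K}}\mathcal{J}(K)$ of the form $K^*=R^{-1}B^\top P_{K^*}$. Suppose $K_0\in\mathcal{K}$, $\|K_0\|<\infty$, $(A,C)$ is detectable, and $DD^\top>0$. Let $\{K_n\}_{n\ge0}$ be generated from $K_0$, with a constant stepsize $\eta>0$, by either (a) the natural policy gradient iteration $K_{n+1}=K_n-2\eta(RK_n-B^\top P_{K_n})$ with $\eta\le\dfrac{1}{2\|R\|}$, or (b) the Gauss–Newton iteration $K_{n+1}=K_n-2\eta(K_n-R^{-1}B^\top P_{K_n})$ with $\eta\le\dfrac12$. Then the iterates converge to the optimal gain $K^*$ with locally linear rate, in the sense that $\{\mathcal{J}(K_n)\}$ converges to $\mathcal{J}(K^* )$ with a linear rate locally: there exist $n_0$ and $\varrho\in(0,1)$ such that $\mathcal{J}(K_{n+1})-\mathcal{J}(K^* )\le\varrho\,[\mathcal{J}(K_n)-\mathcal{J}(K^* )]$ for all $n\ge n_0$. In addition, if $\eta=1/2$, the Gauss–Newton iteration converges to $K^*$ with a locally Q-quadratic rate: there exist $n_0$ and $c>0$ such that $\mathcal{J}(K_{n+1})-\mathcal{J}(K^* )\le c\,[\mathcal{J}(K_n)-\mathcal{J}(K^* )]^2$ for all $n\ge n_0$.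
   Context: Setting (continuous-time mixed $\mathcal{H}_2/\mathcal{H}_\infty$ design). $A\in\mathbb{R}^{m\times m}$, $B\in\mathbb{R}^{m\times d}$, $C\in\mathbb{R}^{l\times m}$, $D\in\mathbb{R}^{m\times n}$, $E\in\mathbb{R}^{l\times d}$ are real matrices satisfying $E^\top[C\ \ E]=[0\ \ R]$ for some $R>0$, and $\gamma>0$. Gains are $K\in\mathbb{R}^{d\times m}$. $\|\cdot\|$ is the operator norm; $X>0$ ($X\ge0$) denotes (symmetric) positive definite (semidefinite). A matrix is Hurwitz if all its eigenvalues have negative real part. Transfer function: $\mathcal{T}(K)(s)=(C^\top C+K^\top RK)^{1/2}(sI-(A-BK))^{-1}D$, with $\|\mathcal{T}(K)\|_\infty=\sup_{\omega\in\mathbb{R}}\sigma_{\max}[\mathcal{T}(K)(j\omega)]$. Feasible set: $\mathcal{K}=\{K: A-BK\text{ is Hurwitz},\ \|\mathcal{T}(K)\|_\infty<\gamma\}$. For $K\in\mathcal{K}$, $P_K\ge0$ denotes the unique stabilizing solution (it exists by the continuous-time Bounded Real Lemma) of $(A-BK)^\top P_K+P_K(A-BK)+C^\top C+K^\top RK+\gamma^{-2}P_KDD^\top P_K=0$, i.e., the unique solution with $A-BK+\gamma^{-2}DD^\top P_K$ Hurwitz. Cost: $\mathcal{J}(K)=\mathrm{tr}(P_KDD^\top)$ for $K\in\mathcal{K}$. *)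

(* Defs.v *)
From HB Require Import structures.
From mathcomp Require Import all_boot all_order all_algebra.
From mathcomp Require Import all_classical all_reals all_analysis.
From mathcomp Require Import complex.

Set Implicit Arguments.
Unset Strict Implicit.
Unset Printing Implicit Defensive.

Import Order.TTheory GRing.Theory Num.Theory.
Import numFieldNormedType.Exports.

Local Open Scope ring_scope.
Local Open Scope classical_set_scope.
Local Open Scope complex_scope.
Local Open Scope sesquilinear_scope.

Definition psdmx (R : realType) (k : nat) (X : 'M[R]_k) : Prop :=
  X^T = X /\ forall v : 'cV[R]_k, 0 <= (v^T *m X *m v) 0 0.

Definition pdmx (R : realType) (k : nat) (X : 'M[R]_k) : Prop :=
  X^T = X /\ forall v : 'cV[R]_k, v != 0 -> 0 < (v^T *m X *m v) 0 0.

Definition cplxmx (R : realType) (p q : nat) (M : 'M[R]_(p, q)) :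
    'M[R[i]]_(p, q) :=
  map_mx (real_complex R) M.

Definition hurwitz (R : realType) (k : nat) (M : 'M[R]_k) : Prop :=
  forall z : R[i], eigenvalue (cplxmx M) z -> complex.Re z < 0.

Definition detectable (R : realType) (m l : nat)
    (A : 'M[R]_m) (C : 'M[R]_(l, m)) : Prop :=
  exists L : 'M[R]_(m, l), hurwitz (A - L *m C).

Definition norm2 (R : realType) (k : nat) (v : 'cV[R]_k) : R :=
  Num.sqrt (\sum_i v i 0 ^+ 2).

(* Taking the supremum over the closed unit ball rather than the unit sphere
   keeps the set nonempty when q = 0. *)
Definition opnorm (R : realType) (p q : nat) (M : 'M[R]_(p, q)) : R :=
  sup [set norm2 (M *m v) | v in [set v : 'cV[R]_q | norm2 v <= 1]].

(* The singular values of M are the square roots of the eigenvalues of M^* M.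
   The set is finite, and empty only when q = 0, in which case sup is 0. *)
Definition sigma_max (R : realType) (p q : nat) (M : 'M[R[i]]_(p, q)) : R :=
  sup [set s : R | 0 <= s /\ eigenvalue (M ^t* *m M) ((s ^+ 2)%:C)].

(* xget picks the (unique) symmetric positive semidefinite square root of a
   positive semidefinite X; the value is 0 if there is none. *)
Definition sqrtmx (R : realType) (k : nat) (X : 'M[R]_k) : 'M[R]_k :=
  xget 0 [set S : 'M[R]_k | psdmx S /\ S *m S = X].

Definition Qcl (R : realType) (m d l : nat) (C : 'M[R]_(l, m))
    (Rw : 'M[R]_d) (K : 'M[R]_(d, m)) : 'M[R]_m :=
  C^T *m C + K^T *m Rw *m K.

Definition transfer (R : realType) (m d l n : nat) (A : 'M[R]_m)
    (B : 'M[R]_(m, d)) (C : 'M[R]_(l, m)) (D : 'M[R]_(m, n)) (Rw : 'M[R]_d)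
    (K : 'M[R]_(d, m)) (s : R[i]) : 'M[R[i]]_(m, n) :=
  cplxmx (sqrtmx (Qcl C Rw K)) *m invmx (s%:M - cplxmx (A - B *m K))
    *m cplxmx D.

(* Extended-real valued, so that an unbounded frequency response has norm +oo
   (the real-valued sup would return 0). *)
Definition hinf_norm (R : realType) (m d l n : nat) (A : 'M[R]_m)
    (B : 'M[R]_(m, d)) (C : 'M[R]_(l, m)) (D : 'M[R]_(m, n)) (Rw : 'M[R]_d)
    (K : 'M[R]_(d, m)) : \bar R :=
  ereal_sup
    [set (sigma_max (transfer A B C D Rw K (0 +i* w)))%:E | w in [set: R]].

Definition feasible (R : realType) (m d l n : nat) (A : 'M[R]_m)
    (B : 'M[R]_(m, d)) (C : 'M[R]_(l, m)) (D : 'M[R]_(m, n)) (Rw : 'M[R]_d)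
    (gamma : R) : set 'M[R]_(d, m) :=
  [set K | hurwitz (A - B *m K) /\ (hinf_norm A B C D Rw K < gamma%:E)%E].

Definition stabilizing_solution (R : realType) (m d l n : nat) (A : 'M[R]_m)
    (B : 'M[R]_(m, d)) (C : 'M[R]_(l, m)) (D : 'M[R]_(m, n)) (Rw : 'M[R]_d)
    (gamma : R) (K : 'M[R]_(d, m)) (P : 'M[R]_m) : Prop :=
  [/\ psdmx P,
      (A - B *m K)^T *m P + P *m (A - B *m K) + C^T *m C + K^T *m Rw *m K
        + gamma ^- 2 *: (P *m D *m D^T *m P) = 0
    & hurwitz (A - B *m K + gamma ^- 2 *: (D *m D^T *m P))].

(* P_K. For feasible K the stabilizing solution exists and is unique (Bounded
   Real Lemma), so xget returns it; when there is none the value is 0. *)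
Definition ricc (R : realType) (m d l n : nat) (A : 'M[R]_m)
    (B : 'M[R]_(m, d)) (C : 'M[R]_(l, m)) (D : 'M[R]_(m, n)) (Rw : 'M[R]_d)
    (gamma : R) (K : 'M[R]_(d, m)) : 'M[R]_m :=
  xget 0 [set P | stabilizing_solution A B C D Rw gamma K P].

(* Meaningful only for feasible K, as ricc is. *)
Definition cost (R : realType) (m d l n : nat) (A : 'M[R]_m)
    (B : 'M[R]_(m, d)) (C : 'M[R]_(l, m)) (D : 'M[R]_(m, n)) (Rw : 'M[R]_d)
    (gamma : R) (K : 'M[R]_(d, m)) : R :=
  \tr (ricc A B C D Rw gamma K *m D *m D^T).

Definition natural_pg_iter (R : realType) (m d l n : nat) (A : 'M[R]_m)
    (B : 'M[R]_(m, d)) (C : 'M[R]_(l, m)) (D : 'M[R]_(m, n)) (Rw : 'M[R]_d)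
    (gamma eta : R) (K : nat -> 'M[R]_(d, m)) : Prop :=
  forall k, K k.+1 =
    K k - (2 * eta) *: (Rw *m K k - B^T *m ricc A B C D Rw gamma (K k)).

Definition gauss_newton_iter (R : realType) (m d l n : nat) (A : 'M[R]_m)
    (B : 'M[R]_(m, d)) (C : 'M[R]_(l, m)) (D : 'M[R]_(m, n)) (Rw : 'M[R]_d)
    (gamma eta : R) (K : nat -> 'M[R]_(d, m)) : Prop :=
  forall k, K k.+1 =
    K k - (2 * eta) *:
      (K k - invmx Rw *m B^T *m ricc A B C D Rw gamma (K k)).

(* Main.v *)
(* Write [N(P)] for the algebraic Riccati operator of the game. For a gain [K]
   with stabilizing solution [P], [Dl = K - R^-1 B^T P] measures the distance
   to optimality: [N(P) = - Dl^T R Dl]. Both updates have the form [K' = K - M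
   Dl], where [(1 - M)^T R (1 - M) <= (1 - c) R] for some [0 < c <= 1]; hence
   [P] is a supersolution of the Riccati equation of [K'], up to [- c Dl^T R
   Dl]. Newton's method below this supersolution yields a stabilizing solution
   [P' <= P], and a strict supersolution obtained by perturbation bounds the
   H-infinity norm of [K'] strictly below [gamma], so [K'] is feasible.

   The [P_k] decrease, hence converge to some [P]; the decrease of [P_k] forces
   [Dl_k -> 0], so [N(P) = 0], and the limit closed loop has its spectrum in
   the closed left half plane. As [N(Pst) = 0] with a Hurwitz closed loop, [P -
   Pst] solves a homogeneous Sylvester equation with disjoint spectra and
   vanishes.

   For the rates, let [Sg] solve the dual Lyapunov equation of the optimal
   closed loop [Ast], [Ast Sg + Sg Ast^T] being minus the noise covariance.
   Pairing the expansions at [Pst] with [Sg] gives, for the gap [e_k] of the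
   costs, [tr (Sg Dl_k^T R Dl_k) = e_k + O(e_k^2)] and [(1 - o(1)) e_{k+1} <=
   (1 + theta) (1 - c) e_k + O(e_k^2)] for every [theta > 0]; [c = 1] for the
   Gauss-Newton update with [eta = 1/2].

   The existence part of the bounded real lemma, needed for the initial and the
   optimal gain, is proved by continuation in the coefficient [gamma^-2]: the
   only obstruction is an imaginary eigenvalue of the closed loop, which would
   make a singular value of the frequency response reach [gamma]. *)
Require Import Defs.
From HB Require Import structures.
From mathcomp Require Import all_boot all_order all_algebra.
From mathcomp Require Import all_classical all_reals all_analysis.
From mathcomp Require Import complex.
From mathcomp Require Import ring lra.

Set Implicit Arguments.
Unset Strict Implicit.
Unset Printing Implicit Defensive.

Import Order.TTheory GRing.Theory Num.Theory.
Import numFieldNormedType.Exports.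

Local Open Scope ring_scope.
Local Open Scope classical_set_scope.

Require Import Defs.
From HB Require Import structures.
From mathcomp Require Import all_boot all_order all_algebra.
From mathcomp Require Import all_classical all_reals all_analysis.
From mathcomp Require Import complex.
From mathcomp Require Import ring lra.

Set Implicit Arguments.
Unset Strict Implicit.
Unset Printing Implicit Defensive.

Import Order.TTheory GRing.Theory Num.Theory.
Import numFieldNormedType.Exports.

Local Open Scope ring_scope.
Local Open Scope classical_set_scope.

(** * Entrywise rules and noncommutative matrix identities *)

Lemma addmxE (R : nmodType) m n (A B : 'M[R]_(m, n)) i j :
  (A + B) i j = A i j + B i j.
Proof. exact: mxE. Qed.

Lemma oppmxE (R : zmodType) m n (A : 'M[R]_(m, n)) i j : (- A) i j = - A i j.
Proof. exact: mxE. Qed.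

Lemma scalemxE (R : pzRingType) m n (a : R) (A : 'M[R]_(m, n)) i j :
  (a *: A) i j = a * A i j.
Proof. exact: mxE. Qed.

Lemma mx0E (R : nmodType) m n i j : (0 : 'M[R]_(m, n)) i j = 0.
Proof. exact: mxE. Qed.

Lemma trmx_add (R : nmodType) m n (A B : 'M[R]_(m, n)) : (A + B)^T = A^T + B^T.
Proof. exact: raddfD. Qed.

Lemma trmx_opp (R : zmodType) m n (A : 'M[R]_(m, n)) : (- A)^T = - A^T.
Proof. exact: raddfN. Qed.

Lemma trmx_scale (R : pzRingType) m n (a : R) (A : 'M[R]_(m, n)) :
  (a *: A)^T = a *: A^T.
Proof. exact: linearZ. Qed.

Ltac mxexpand :=
  rewrite ?(trmx_mul, trmx_add, trmx_opp, trmx_scale, trmxK, trmx1);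
  rewrite ?(mulmxDl, mulmxDr, mulmxN, mulNmx, scalerDr, scalerN, mulmxA);
  rewrite -?(scalemxAl, scalemxAr);
  rewrite ?(mulmxDl, mulmxDr, mulmxN, mulNmx, scalerDr, scalerN, mulmxA,
    mul1mx, mulmx1, mul0mx, mulmx0, mul_scalar_mx, mul_mx_scalar).

(* Noncommutative polynomial identities between matrices: after expansion, each
   entry is a linear identity whose atoms are the entries of the monomials. *)
Ltac mxring :=
  mxexpand; apply/matrixP => ? ?;
  rewrite ?(addmxE, oppmxE, scalemxE, mx0E); ring.

(** * Quadratic forms and the Loewner order *)

Section Forms.
Variable R : realType.

Definition bf m (X : 'M[R]_m) (u v : 'cV[R]_m) : R := (u^T *m X *m v) 0 0.
Definition qf m (X : 'M[R]_m) (v : 'cV[R]_m) : R := (v^T *m X *m v) 0 0.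

Lemma qfE m (X : 'M[R]_m) v : qf X v = bf X v v.
Proof. by []. Qed.

Lemma bfDl m (X : 'M[R]_m) u1 u2 v : bf X (u1 + u2) v = bf X u1 v + bf X u2 v.
Proof. by rewrite /bf; mxexpand; rewrite addmxE. Qed.
Lemma bfDr m (X : 'M[R]_m) u v1 v2 : bf X u (v1 + v2) = bf X u v1 + bf X u v2.
Proof. by rewrite /bf; mxexpand; rewrite addmxE. Qed.
Lemma bfZl m (X : 'M[R]_m) a u v : bf X (a *: u) v = a * bf X u v.
Proof. by rewrite /bf; mxexpand; rewrite scalemxE. Qed.
Lemma bfZr m (X : 'M[R]_m) a u v : bf X u (a *: v) = a * bf X u v.
Proof. by rewrite /bf; mxexpand; rewrite scalemxE. Qed.
Lemma bfNl m (X : 'M[R]_m) u v : bf X (- u) v = - bf X u v.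
Proof. by rewrite -scaleN1r bfZl mulN1r. Qed.
Lemma bfNr m (X : 'M[R]_m) u v : bf X u (- v) = - bf X u v.
Proof. by rewrite -scaleN1r bfZr mulN1r. Qed.
Lemma bf0l m (X : 'M[R]_m) v : bf X 0 v = 0.
Proof. by rewrite -(scale0r 0) bfZl mul0r. Qed.
Lemma bf_mxD m (X Y : 'M[R]_m) u v : bf (X + Y) u v = bf X u v + bf Y u v.
Proof. by rewrite /bf; mxexpand; rewrite addmxE. Qed.
Lemma bf_mxN m (X : 'M[R]_m) u v : bf (- X) u v = - bf X u v.
Proof. by rewrite /bf; mxexpand; rewrite oppmxE. Qed.
Lemma bf_mxZ m a (X : 'M[R]_m) u v : bf (a *: X) u v = a * bf X u v.
Proof. by rewrite /bf; mxexpand; rewrite scalemxE. Qed.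
Lemma bf_mx0 m u v : bf (0 : 'M[R]_m) u v = 0.
Proof. by rewrite /bf mulmx0 mul0mx mxE. Qed.
Lemma bf_tr m (X : 'M[R]_m) u v : bf X^T u v = bf X v u.
Proof.
rewrite /bf -[RHS](mxE tt (fun i j => (v^T *m X *m u) j i)).
have -> : \matrix[tt]_(i, j) (v^T *m X *m u) j i = (v^T *m X *m u)^T.
  by apply/matrixP=> i j; rewrite !mxE.
by rewrite !trmx_mul trmxK mulmxA.
Qed.
Lemma bf_sym m (X : 'M[R]_m) u v : X^T = X -> bf X u v = bf X v u.
Proof. by move=> XT; rewrite -{1}XT bf_tr. Qed.
Lemma bf_congr m k (X : 'M[R]_m) (M N : 'M[R]_(m, k)) u v :
  bf (M^T *m X *m N) u v = bf X (M *m u) (N *m v).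
Proof. by rewrite /bf trmx_mul !mulmxA. Qed.
Lemma bf_mulr m (X Y : 'M[R]_m) u v : bf (X *m Y) u v = bf X u (Y *m v).
Proof. by rewrite /bf !mulmxA. Qed.
Lemma bf_mull m (X Y : 'M[R]_m) u v : bf (X^T *m Y) u v = bf Y (X *m u) v.
Proof. by rewrite /bf trmx_mul !mulmxA. Qed.

Lemma bf_delta m (X : 'M[R]_m) i j : bf X (delta_mx i 0) (delta_mx j 0) = X i j.
Proof. by rewrite /bf trmx_delta -rowE -colE !mxE. Qed.

Lemma bf_deltal m (X : 'M[R]_m) i v : bf X (delta_mx i 0) v = (X *m v) i 0.
Proof. by rewrite /bf trmx_delta -rowE -row_mul [LHS]mxE. Qed.

Lemma qfD m (X Y : 'M[R]_m) v : qf (X + Y) v = qf X v + qf Y v.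
Proof. exact: bf_mxD. Qed.
Lemma qfN m (X : 'M[R]_m) v : qf (- X) v = - qf X v.
Proof. exact: bf_mxN. Qed.
Lemma qfB m (X Y : 'M[R]_m) v : qf (X - Y) v = qf X v - qf Y v.
Proof. by rewrite qfD qfN. Qed.
Lemma qfZ m a (X : 'M[R]_m) v : qf (a *: X) v = a * qf X v.
Proof. exact: bf_mxZ. Qed.
Lemma qf_mx0 m v : qf (0 : 'M[R]_m) v = 0.
Proof. exact: bf_mx0. Qed.
Lemma qf0 m (X : 'M[R]_m) : qf X 0 = 0.
Proof. exact: bf0l. Qed.
Lemma qf_congr m k (X : 'M[R]_m) (M : 'M[R]_(m, k)) v :
  qf (M^T *m X *m M) v = qf X (M *m v).
Proof. exact: bf_congr. Qed.

Lemma qf1E m (v : 'cV[R]_m) : qf 1%:M v = \sum_i v i 0 ^+ 2.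
Proof.
rewrite /qf mulmx1 mxE; apply: eq_bigr => i _.
by rewrite mxE expr2.
Qed.

Lemma qf1_ge0 m (v : 'cV[R]_m) : 0 <= qf 1%:M v.
Proof. by rewrite qf1E; apply: sumr_ge0 => i _; rewrite sqr_ge0. Qed.

Lemma qf1_eq0 m (v : 'cV[R]_m) : qf 1%:M v = 0 -> v = 0.
Proof.
rewrite qf1E => /eqP; rewrite psumr_eq0; last by move=> i _; rewrite sqr_ge0.
move=> /allP h; apply/matrixP => i j; rewrite (ord1 j) mxE.
by have := h i (mem_index_enum _); rewrite sqrf_eq0 => /eqP.
Qed.

Lemma qf1_gt0 m (v : 'cV[R]_m) : v != 0 -> 0 < qf 1%:M v.
Proof.
move=> v0; rewrite lt_neqAle qf1_ge0 andbT eq_sym.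
by apply: contra v0 => /eqP /qf1_eq0 ->.
Qed.

Lemma psdD m (X Y : 'M[R]_m) : psdmx X -> psdmx Y -> psdmx (X + Y).
Proof.
move=> [XT X0] [YT Y0]; split; first by rewrite linearD /= XT YT.
by move=> v; rewrite -/(qf _ _) qfD; apply: addr_ge0; [exact: X0 | exact: Y0].
Qed.

Lemma psdZ m a (X : 'M[R]_m) : 0 <= a -> psdmx X -> psdmx (a *: X).
Proof.
move=> a0 [XT X0]; split; first by rewrite linearZ /= XT.
by move=> v; rewrite -/(qf _ _) qfZ mulr_ge0 //; exact: X0.
Qed.

Lemma psd0 m : psdmx (0 : 'M[R]_m).
Proof. by split; [rewrite trmx0 | move=> v; rewrite -/(qf _ _) qf_mx0]. Qed.

Lemma psd1 m : psdmx (1%:M : 'M[R]_m).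
Proof. by split; [rewrite trmx1 | move=> v; exact: qf1_ge0]. Qed.

Lemma psd_congr m k (X : 'M[R]_m) (M : 'M[R]_(m, k)) :
  psdmx X -> psdmx (M^T *m X *m M).
Proof.
move=> [XT X0]; split; first by rewrite !trmx_mul trmxK XT mulmxA.
by move=> v; rewrite -/(qf _ _) qf_congr; exact: X0.
Qed.

Lemma psd_gram m k (M : 'M[R]_(m, k)) : psdmx (M^T *m M).
Proof. by rewrite -[M in _ *m M]mul1mx mulmxA; apply/psd_congr/psd1. Qed.

Lemma pd_psd m (X : 'M[R]_m) : pdmx X -> psdmx X.
Proof.
move=> [XT X0]; split=> // v.
have [->|/X0/ltW//] := eqVneq v 0.
by rewrite mulmx0 mxE.
Qed.

Lemma psd_subrr m (X : 'M[R]_m) : psdmx (X - X).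
Proof. by rewrite subrr; exact: psd0. Qed.

Lemma psd_le_trans m (Y X Z : 'M[R]_m) :
  psdmx (Y - X) -> psdmx (Z - Y) -> psdmx (Z - X).
Proof. by move=> h1 h2; rewrite -(subrKA Y) addrC; apply: psdD; rewrite // addrC. Qed.

Lemma psd_cauchy m (X : 'M[R]_m) u v : psdmx X -> bf X u v ^+ 2 <= qf X u * qf X v.
Proof.
move=> [XT X0]; have Xq w : 0 <= qf X w by exact: X0.
(* With [a], [b], [c] as set below, the form at this vector is [b (a b - c^2)], which settles the
   case [b > 0]. *)
have := Xq (qf X v *: u - bf X u v *: v).
rewrite !qfE !(bfDl, bfDr, bfNl, bfNr, bfZl, bfZr) -!qfE (bf_sym v u)//.
set a := qf X u; set b := qf X v; set c := bf X u v => h.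
have b0 : 0 <= b by exact: Xq.
have a0 : 0 <= a by exact: Xq.
have {}h : 0 <= b * (a * b - c ^+ 2) by move: h; congr (_ <= _); ring.
have [bp|] := ltP 0 b; first by move: h; rewrite pmulr_rge0 // subr_ge0.
move=> bn; have bz : b = 0 by apply/eqP; rewrite eq_le b0 bn.
(* The form at [u - t v] is [a - 2 t c], for every [t], so [c] must vanish. *)
rewrite bz mulr0; have [->|c0] := eqVneq c 0; first by rewrite expr0n.
have := Xq (u - ((a + 1) / (2 * c)) *: v).
rewrite !qfE !(bfDl, bfDr, bfNl, bfNr, bfZl, bfZr) -!qfE (bf_sym v u)//.
rewrite -/a -/b -/c bz => h2; exfalso.
suff : a - (a + 1) >= 0 by lra.
by move: h2; congr (_ <= _); field.
Qed.

Lemma psd_qf0 m (X : 'M[R]_m) v : psdmx X -> qf X v = 0 -> X *m v = 0.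
Proof.
move=> Xp v0; apply/matrixP => i j; rewrite (ord1 j) mx0E.
have -> : (X *m v) i 0 = bf X (delta_mx i 0) v.
  by rewrite bf_deltal.
have := psd_cauchy (delta_mx i 0) v Xp; rewrite v0 mulr0.
by move=> h; apply/eqP; rewrite -sqrf_eq0 eq_le h sqr_ge0.
Qed.

Lemma psd_diag m (X : 'M[R]_m) i : psdmx X -> 0 <= X i i.
Proof. by move=> [_ X0]; rewrite -bf_delta; exact: X0. Qed.

Lemma psd_tr m (X : 'M[R]_m) : psdmx X -> 0 <= \tr X.
Proof. by move=> Xp; apply: sumr_ge0 => i _; exact: psd_diag. Qed.

(** Cauchy-Schwarz against each basis vector. It lets a term [X S X] be absorbed into a multiple of
    [X] once [X] is small. *)
Lemma psd_mul_sqr m (X : 'M[R]_m) v : psdmx X ->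
  qf 1%:M (X *m v) <= \tr X * qf X v.
Proof.
move=> Xp; rewrite qf1E mulr_suml; apply: ler_sum => i _.
have -> : (X *m v) i 0 = bf X (delta_mx i 0) v.
  by rewrite bf_deltal.
by apply: (le_trans (psd_cauchy _ _ Xp)); rewrite [qf X (delta_mx _ _)]qfE bf_delta.
Qed.

Lemma psd_entry m (X : 'M[R]_m) i j : psdmx X -> `|X i j| <= \tr X.
Proof.
move=> Xp; have [XT X0] := Xp.
have p1 := X0 (delta_mx i 0 + delta_mx j 0); have p2 := X0 (delta_mx i 0 - delta_mx j 0).
move: p1 p2; rewrite -!/(qf _ _) !qfE !(bfDl, bfDr, bfNl, bfNr, bf_delta).
have -> : X j i = X i j by rewrite -[in RHS]XT mxE.
move=> p1 p2.
have tr_ge k : X k k <= \tr X.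
  by rewrite /mxtrace (bigD1 k) //= lerDl; apply: sumr_ge0 => ? _; exact: psd_diag.
have := tr_ge i; have := tr_ge j => ? ?.
by rewrite ler_norml; apply/andP; split; lra.
Qed.

Lemma pd_unit m (X : 'M[R]_m) : pdmx X -> X \in unitmx.
Proof.
move=> [XT X0]; rewrite -row_free_unit -kermx_eq0; apply/eqP/row_matrixP => i.
rewrite row0; apply/eqP; apply: contraT => r0.
have hr : row i (kermx X) *m X = 0 by rewrite -row_mul mulmx_ker row0.
have := X0 (row i (kermx X))^T; rewrite trmxK hr mul0mx mxE ltxx => /(_ _)//.
by rewrite -(inj_eq trmx_inj) trmxK trmx0 => /(_ r0).
Qed.

(** Each coordinate of [v] is [bf X] of [invmx X *m delta_mx i 0] and [v], so Cauchy-Schwarz gives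
    [|v|^2 <= tr (X^-1) v^T X v]; the trace of the inverse does the work of the smallest
    eigenvalue. *)
Lemma pd_ge m (X : 'M[R]_m) : pdmx X ->
  exists2 delta, 0 < delta & psdmx (X - delta *: 1%:M).
Proof.
move=> Xpd; have Xp := pd_psd Xpd; have Xu := pd_unit Xpd.
have [XT X0] := Xpd.
have Xi : psdmx (invmx X).
  have -> : invmx X = (invmx X)^T *m X *m invmx X.
    by rewrite -mulmxA mulmxV // mulmx1 trmx_inv XT.
  exact: psd_congr.
have t0 := psd_tr Xi.
exists (\tr (invmx X) + 1)^-1; first by rewrite invr_gt0; lra.
split; first by rewrite linearB linearZ /= trmx1 XT.
move=> v; rewrite -/(qf _ _) qfB qfZ subr_ge0 -[_ * _]mulrC ler_pdivrMr; last by lra.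
have : qf 1%:M v <= \tr (invmx X) * qf X v.
  rewrite qf1E mulr_suml; apply: ler_sum => i _.
  have -> : v i 0 = bf X (invmx X *m delta_mx i 0) v.
    rewrite /bf trmx_mul trmx_inv XT trmx_delta -(mulmxA _ (invmx X)) mulVmx //.
    by rewrite mulmx1 -rowE mxE.
  apply: (le_trans (psd_cauchy _ _ Xp)).
  rewrite ler_wpM2r //; first exact: (proj2 Xp).
  by rewrite qfE -bf_congr trmx_inv XT -mulmxA mulmxV // mulmx1 bf_delta.
have := (proj2 Xp) v; rewrite -/(qf _ _); lra.
Qed.

Lemma psd_shift_pd m (X : 'M[R]_m) delta : 0 < delta ->
  psdmx (X - delta *: 1%:M) -> pdmx X.
Proof.
move=> d0 [XT X0]; split.
  by have := XT; rewrite linearB linearZ /= trmx1 => /addIr.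
move=> v v0; have := X0 v; rewrite -!/(qf _ _) qfB qfZ.
by have := mulr_gt0 d0 (qf1_gt0 v0); lra.
Qed.

Lemma psd_inj_pd m (X : 'M[R]_m) :
  psdmx X -> (forall v : 'cV[R]_m, X *m v = 0 -> v = 0) -> pdmx X.
Proof.
move=> Xp inj; split; first by case: Xp.
move=> v v0; rewrite -/(qf _ _) lt_neqAle [X in _ && X](proj2 Xp) andbT eq_sym.
by apply: contra v0 => /eqP /(psd_qf0 Xp) /inj ->.
Qed.

(** The working norm of the estimates: submultiplicative, invariant under transposition, and
    bounding traces and quadratic forms. *)
Definition l1 m n (X : 'M[R]_(m, n)) : R := \sum_i \sum_j `|X i j|.

Lemma l1_ge0 m n (X : 'M[R]_(m, n)) : 0 <= l1 X.
Proof. by apply: sumr_ge0 => i _; apply: sumr_ge0. Qed.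

Lemma l1_entry m n (X : 'M[R]_(m, n)) i j : `|X i j| <= l1 X.
Proof.
rewrite /l1 (bigD1 i) //= (bigD1 j) //= -addrA lerDl addr_ge0 //.
  exact: sumr_ge0.
by apply: sumr_ge0 => ? _; exact: sumr_ge0.
Qed.

Lemma l1D m n (X Y : 'M[R]_(m, n)) : l1 (X + Y) <= l1 X + l1 Y.
Proof.
rewrite /l1 -big_split /=; apply: ler_sum => i _.
by rewrite -big_split /=; apply: ler_sum => j _; rewrite mxE ler_normD.
Qed.

Lemma l1_tr m n (X : 'M[R]_(m, n)) : l1 X^T = l1 X.
Proof.
by rewrite /l1 exchange_big; apply: eq_bigr => i _; apply: eq_bigr => j _; rewrite mxE.
Qed.

Lemma l1Z m n a (X : 'M[R]_(m, n)) : l1 (a *: X) = `|a| * l1 X.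
Proof.
rewrite /l1 mulr_sumr; apply: eq_bigr => i _; rewrite mulr_sumr.
by apply: eq_bigr => j _; rewrite mxE normrM.
Qed.

Lemma l1N m n (X : 'M[R]_(m, n)) : l1 (- X) = l1 X.
Proof. by rewrite -scaleN1r l1Z normrN1 mul1r. Qed.

Lemma l1M m n p (X : 'M[R]_(m, n)) (Y : 'M[R]_(n, p)) : l1 (X *m Y) <= l1 X * l1 Y.
Proof.
rewrite {1 2}/l1 mulr_suml; apply: ler_sum => i _.
apply: (@le_trans _ _ (\sum_j \sum_k `|X i k| * `|Y k j|)).
  apply: ler_sum => j _; rewrite mxE; apply: (le_trans (ler_norm_sum _ _ _)).
  by apply: ler_sum => k _; rewrite normrM.
rewrite exchange_big mulr_suml; apply: ler_sum => k _.
rewrite -mulr_sumr ler_wpM2l // /l1 (bigD1 k) //= lerDl.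
by apply: sumr_ge0 => ? _; exact: sumr_ge0.
Qed.

Lemma l1_mxtrace m (X : 'M[R]_m) : `|\tr X| <= l1 X.
Proof.
apply: (le_trans (ler_norm_sum _ _ _)); apply: ler_sum => i _.
by rewrite (bigD1 i) //= lerDl sumr_ge0.
Qed.

Lemma qf_l1 m (X : 'M[R]_m) v : `|qf X v| <= l1 X * qf 1%:M v.
Proof.
have e2 i j : `|v i 0 * v j 0| <= qf 1%:M v.
  have tr_ge k : v k 0 ^+ 2 <= qf 1%:M v.
    by rewrite qf1E (bigD1 k) //= lerDl sumr_ge0 // => ? _; rewrite sqr_ge0.
  have h1 := tr_ge i; have h2 := tr_ge j.
  have h3 := sqr_ge0 (v i 0 - v j 0); have h4 := sqr_ge0 (v i 0 + v j 0).
  by rewrite ler_norml; apply/andP; split; nra.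
rewrite /qf mxE; apply: (le_trans (ler_norm_sum _ _ _)).
rewrite /l1 exchange_big mulr_suml; apply: ler_sum => j _.
rewrite mxE mulr_suml mulr_suml; apply: (le_trans (ler_norm_sum _ _ _)).
apply: ler_sum => i _; rewrite mxE -mulrA mulrCA normrM.
by rewrite ler_wpM2l // e2.
Qed.

Lemma psd_le_l1 m (X : 'M[R]_m) : X^T = X -> psdmx (l1 X *: 1%:M - X).
Proof.
move=> XT; split; first by rewrite linearB linearZ /= trmx1 XT.
move=> v; rewrite -/(qf _ _) qfB qfZ subr_ge0.
by apply: (le_trans (ler_norm _)); exact: qf_l1.
Qed.

Lemma psd_l1 m (X : 'M[R]_m) : psdmx X -> l1 X <= (m * m)%:R * \tr X.
Proof.
move=> Xp; rewrite /l1.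
apply: (@le_trans _ _ (\sum_(i < m) \sum_(j < m) \tr X)).
  by apply: ler_sum => i _; apply: ler_sum => j _; exact: psd_entry.
by rewrite !sumr_const !card_ord -mulrnA [leRHS]mulr_natl.
Qed.

(* [a + i b] is an eigenvector of [A] for the eigenvalue [al + i be]. *)
Definition eigpair m (A : 'M[R]_m) (al be : R) (a b : 'cV[R]_m) : Prop :=
  [/\ A *m a = al *: a - be *: b, A *m b = be *: a + al *: b & (a != 0) || (b != 0)].

(** Real form of [v^* (A^T X + X A) v = 2 Re(z) v^* X v] for an eigenvector [v = a + i b]; the cross
    terms cancel because [X] is symmetric. *)
Lemma lyap_eigpair m (A X : 'M[R]_m) al be a b : X^T = X -> eigpair A al be a b ->
  qf (A^T *m X + X *m A) a + qf (A^T *m X + X *m A) b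
  = 2 * al * (qf X a + qf X b).
Proof.
move=> XT [Aa Ab _]; rewrite !qfD !qfE !bf_mull !bf_mulr Aa Ab.
rewrite !(bfDl, bfDr, bfNl, bfNr, bfZl, bfZr) (bf_sym b a) //; ring.
Qed.

End Forms.
(** * Eigenvalues in real terms and the Sylvester equation *)

Section ComplexReal.
Variable R : realType.
Local Notation C := R[i].

Definition cm p q (A B : 'M[R]_(p, q)) : 'M[C]_(p, q) :=
  cplxmx A + ('i)%C *: cplxmx B.

Lemma cmE p q (A B : 'M[R]_(p, q)) i j : cm A B i j = (A i j +i* B i j)%C.
Proof.
rewrite /cm /cplxmx !mxE; apply/eqP; rewrite eq_complex /=.
by rewrite !mul0r !mul1r subr0 addr0 !add0r !eqxx.
Qed.

Lemma cm_ReIm p q (W : 'M[C]_(p, q)) :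
  W = cm (map_mx (@complex.Re R) W) (map_mx (@complex.Im R) W).
Proof. by apply/matrixP => i j; rewrite cmE !mxE; case: (W i j). Qed.

Lemma cm_inj p q (A B A' B' : 'M[R]_(p, q)) : cm A B = cm A' B' -> A = A' /\ B = B'.
Proof.
by move=> e; split; apply/matrixP => i j; move/matrixP: e => /(_ i j);
  rewrite !cmE => -[].
Qed.

Lemma cplxmx_mul p q r (M : 'M[R]_(p, q)) (N : 'M[R]_(q, r)) :
  cplxmx (M *m N) = cplxmx M *m cplxmx N.
Proof. exact: map_mxM. Qed.

Lemma mul_cplxmx_cm p q r (M : 'M[R]_(p, q)) (A B : 'M[R]_(q, r)) :
  cplxmx M *m cm A B = cm (M *m A) (M *m B).
Proof. by rewrite /cm mulmxDr -scalemxAr !cplxmx_mul. Qed.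

Lemma scale_cm p q (z : C) (A B : 'M[R]_(p, q)) :
  z *: cm A B = cm (complex.Re z *: A - complex.Im z *: B)
                   (complex.Im z *: A + complex.Re z *: B).
Proof.
apply/matrixP => i j; rewrite [LHS]scalemxE !cmE; case: z => x y.
by rewrite !(addmxE, oppmxE, scalemxE); apply/eqP; rewrite eq_complex /= addrC
  [X in _ && (X == _)]addrC [in X in _ && X]addrC !eqxx.
Qed.

Lemma cm_add p q (A B A' B' : 'M[R]_(p, q)) : cm A B + cm A' B' = cm (A + A') (B + B').
Proof. by apply/matrixP => i j; rewrite addmxE !cmE !addmxE. Qed.

Lemma cm_opp p q (A B : 'M[R]_(p, q)) : - cm A B = cm (- A) (- B).
Proof. by apply/matrixP => i j; rewrite oppmxE !cmE !oppmxE. Qed.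

Lemma cm_eq0 p q (A B : 'M[R]_(p, q)) : (cm A B == 0) = (A == 0) && (B == 0).
Proof.
apply/eqP/andP.
  have -> : 0 = cm 0 0 :> 'M[C]_(p, q) by apply/matrixP => i j; rewrite cmE !mxE.
  by move=> /cm_inj[-> ->]; rewrite !eqxx.
by case=> /eqP-> /eqP->; apply/matrixP => i j; rewrite cmE !mxE.
Qed.

Lemma eigenvalue_trmx (F : fieldType) k (A : 'M[F]_k) z :
  eigenvalue A^T z = eigenvalue A z.
Proof.
rewrite !eigenvalue_root_char; congr (root _ z).
rewrite /char_poly -det_tr; congr (\det _).
by apply/matrixP => i j; rewrite !mxE eq_sym.
Qed.

Lemma eigenvalue_col (F : fieldType) k (A : 'M[F]_k) z :
  eigenvalue A z <-> exists2 v : 'cV[F]_k, A *m v = z *: v & v != 0.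
Proof.
rewrite -eigenvalue_trmx; split.
  move=> /eigenvalueP[v vA v0]; exists v^T; last by rewrite -trmx0 (inj_eq trmx_inj).
  by apply: trmx_inj; rewrite trmx_mul trmxK vA linearZ /= trmxK.
move=> [v vA v0]; apply/eigenvalueP; exists v^T; last by rewrite -trmx0 (inj_eq trmx_inj).
by rewrite -trmx_mul vA linearZ.
Qed.

Lemma eigenvalue_eigpair m (A : 'M[R]_m) z :
  eigenvalue (cplxmx A) z <->
  exists a b, eigpair A (complex.Re z) (complex.Im z) a b.
Proof.
rewrite eigenvalue_col; split.
  move=> [v]; rewrite (cm_ReIm v) mul_cplxmx_cm scale_cm => /cm_inj[Aa Ab].
  rewrite cm_eq0 negb_and => v0; exists (map_mx (@complex.Re R) v), (map_mx (@complex.Im R) v).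
  by split.
move=> [a [b [Aa Ab ab0]]]; exists (cm a b); last by rewrite cm_eq0 negb_and.
by rewrite mul_cplxmx_cm scale_cm Aa Ab.
Qed.

Lemma hurwitzP m (A : 'M[R]_m) :
  hurwitz A <-> forall al be a b, eigpair A al be a b -> al < 0.
Proof.
split.
  move=> hA al be a b e; apply: (hA (al +i* be)%C).
  by apply/eigenvalue_eigpair; exists a, b.
by move=> hA z /eigenvalue_eigpair[a [b e]]; apply: hA e.
Qed.

Lemma hurwitz_trmx m (A : 'M[R]_m) : hurwitz A -> hurwitz A^T.
Proof.
move=> hA z; have -> : cplxmx A^T = (cplxmx A)^T by rewrite /cplxmx map_trmx.
by rewrite eigenvalue_trmx; exact: hA.
Qed.

Lemma hurwitz_unit m (A : 'M[R]_m) (z : C) : hurwitz A -> 0 <= complex.Re z ->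
  z%:M - cplxmx A \in unitmx.
Proof.
move=> hA z0; rewrite -row_free_unit -kermx_eq0; apply: contraT => /rowV0Pn[u].
move=> /sub_kermxP; rewrite mulmxBr mul_mx_scalar => /eqP; rewrite subr_eq0 => /eqP uA u0.
have : eigenvalue (cplxmx A) z by apply/eigenvalueP; exists u.
by move/hA; rewrite ltNge z0.
Qed.

(* Sylvester: [p(A1^T) X = X p(- A2)] for [p] the characteristic polynomial of
   [A1^T]; the left side is 0 and [p(- A2)] is a product of units. *)
Lemma sylvester0 m (A1 A2 X : 'M[R]_m) :
  (forall al be a b, eigpair A1 al be a b -> al <= 0) -> hurwitz A2 ->
  A1^T *m X + X *m A2 = 0 -> X = 0.
Proof.
case: m A1 A2 X => [|m] A1 A2 X hA1 hA2 e; first by apply/matrixP => -[].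
pose B1 := (cplxmx A1)^T; pose B2 := cplxmx A2; pose Y := cplxmx X.
have eY : B1 *m Y = Y *m (- B2).
  rewrite mulmxN; apply/eqP; rewrite -addr_eq0 -!cplxmx_mul.
  rewrite /B1 /cplxmx map_trmx -!map_mxM -map_mxD e; apply/eqP.
  exact: map_mx0.
have [rs crs] := closed_field_poly_normal (char_poly B1).
have lc : lead_coef (char_poly B1) = 1 by apply: monicP; exact: char_poly_monic.
rewrite lc scale1r in crs.
have rsP z : z \in rs -> complex.Re z <= 0.
  move=> zrs; have : root (char_poly B1) z by rewrite crs root_prod_XsubC.
  rewrite -eigenvalue_root_char eigenvalue_trmx => /eigenvalue_eigpair[a [b]].
  exact: hA1.
have comm (s : seq C) : horner_mx B1 (\prod_(z <- s) ('X - z%:P)) *m Y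
    = Y *m horner_mx (- B2) (\prod_(z <- s) ('X - z%:P)).
  elim: s => [|z s IH]; first by rewrite !big_nil !rmorph1 mul1mx mulmx1.
  rewrite !big_cons !rmorphM /= -!mulmxE -mulmxA IH !mulmxA; congr (_ *m _).
  rewrite !rmorphB /= !horner_mx_X !horner_mx_C mulmxBl mulmxBr eY.
  by rewrite scalar_mxC.
have unit (s : seq C) : {subset s <= rs} ->
    horner_mx (- B2) (\prod_(z <- s) ('X - z%:P)) \in unitmx.
  elim: s => [|z s IH] srs; first by rewrite big_nil rmorph1 unitmx1.
  rewrite big_cons rmorphM /= unitmx_mul IH ?andbT; last first.
    by move=> w ws; apply: srs; rewrite inE ws orbT.
  rewrite rmorphB /= horner_mx_X horner_mx_C addrC.
  have /rsP z0 : z \in rs by apply: srs; rewrite inE eqxx.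
  rewrite -(raddfN (@scalar_mx _ _)); apply: hurwitz_unit => //.
  by move: z0; case: (z) => x y /= ?; rewrite oppr_ge0.
have := comm rs; rewrite -crs Cayley_Hamilton mul0mx => /esym Y0.
have {}Y0 : Y = 0 by rewrite -(mulmxK (unit rs (fun _ h => h)) Y) -crs Y0 mul0mx.
apply/matrixP => i j; move/matrixP: Y0 => /(_ i j); rewrite !mxE.
by move=> -[].
Qed.

End ComplexReal.
(** * Lyapunov equations *)

Section Lyapunov.
Variable R : realType.

Definition lyap m (A X : 'M[R]_m) : 'M[R]_m := A^T *m X + X *m A.

Lemma lyapD m (A X Y : 'M[R]_m) : lyap A (X + Y) = lyap A X + lyap A Y.
Proof. by rewrite /lyap; mxring. Qed.

Lemma lyapZ m (A X : 'M[R]_m) a : lyap A (a *: X) = a *: lyap A X.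
Proof. by rewrite /lyap; mxring. Qed.

Lemma lyapN m (A X : 'M[R]_m) : lyap A (- X) = - lyap A X.
Proof. by rewrite /lyap; mxring. Qed.

Lemma lyap_sym m (A X : 'M[R]_m) : X^T = X -> (lyap A X)^T = lyap A X.
Proof. by move=> XT; rewrite /lyap trmx_add !trmx_mul XT trmxK addrC. Qed.

Lemma lyap_shift m (A X : 'M[R]_m) t s :
  lyap (A - t *: 1%:M) X = lyap (A - s *: 1%:M) X - (2 * (t - s)) *: X.
Proof. by rewrite /lyap; mxring. Qed.

Lemma qf_lyap_ker m (A X : 'M[R]_m) v : X^T = X -> X *m v = 0 -> qf (lyap A X) v = 0.
Proof.
move=> XT Xv; rewrite qfE bf_mxD bf_mull bf_mulr.
have X0 u : bf X u v = 0 by rewrite /bf -mulmxA Xv mulmx0 mxE.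
by rewrite (bf_sym v) // !X0 addr0.
Qed.

(** The form of [lyap A X] vanishes on the kernel of a symmetric [X], so a strict inequality leaves
    no kernel. *)
Lemma lyap_psd_pd m (A X : 'M[R]_m) :
  psdmx X -> pdmx (- lyap A X) -> pdmx X.
Proof.
move=> Xp [_ L0]; apply: psd_inj_pd => // v Xv; apply/eqP; apply: contraT => /L0.
by rewrite -/(qf _ _) qfN qf_lyap_ker ?oppr0 ?ltxx //; case: Xp.
Qed.

Lemma lyap_pd_hurwitz m (A X : 'M[R]_m) :
  psdmx X -> pdmx (- lyap A X) -> hurwitz A.
Proof.
move=> Xp Lp; have [XT X0] := Xp; apply/hurwitzP => al be a b e.
have := lyap_eigpair XT e; rewrite -/(lyap A X) => E.
have qa := X0 a; have qb := X0 b; rewrite -!/(qf _ _) in qa qb.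
have La := (proj2 (pd_psd Lp)) a; have Lb := (proj2 (pd_psd Lp)) b.
rewrite -!/(qf _ _) !qfN in La Lb.
have : qf (lyap A X) a + qf (lyap A X) b < 0.
  case: e => _ _ /orP[] /(proj2 Lp); rewrite -/(qf _ _) qfN; lra.
by rewrite E; nra.
Qed.

Lemma inf_approx (S : set R) (eps : R) : has_inf S -> 0 < eps ->
  exists2 s, S s & s < inf S + eps.
Proof. by move=> hS e0; exact: inf_adherent. Qed.

(* At the least [s >= 0] with [X + s H >= 0], this matrix is positive definite
   if [s > 0], so that [s] could be decreased. *)
Lemma lyap_pos_cert m (A H X : 'M[R]_m) :
  pdmx H -> pdmx (- lyap A H) -> X^T = X -> psdmx (- lyap A X) -> psdmx X.
Proof.
move=> Hp LH XT LX; have [HT H0] := pd_psd Hp.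
pose S : set R := [set s | 0 <= s /\ psdmx (X + s *: H)].
have symS s : (X + s *: H)^T = X + s *: H by rewrite trmx_add trmx_scale XT HT.
have [dl dl0 Hdl] := pd_ge Hp.
have hS : has_inf S.
  split; last by exists 0 => s [].
  exists (l1 X / dl); split; first by rewrite divr_ge0 ?l1_ge0 // ltW.
  have -> : X + (l1 X / dl) *: H
      = (l1 (- X) *: 1%:M - - X) + (l1 X / dl) *: (H - dl *: 1%:M).
    rewrite l1N scalerBr scalerA divfK ?gt_eqF // opprK.
    by apply/matrixP => ? ?; rewrite ?(addmxE, oppmxE, scalemxE); ring.
  apply: psdD; first by apply: psd_le_l1; rewrite trmx_opp XT.
  by apply: psdZ => //; rewrite divr_ge0 ?l1_ge0 // ltW.
have s0 : 0 <= inf S by apply: lb_le_inf; [case: hS | move=> s []].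
have Y0 : psdmx (X + inf S *: H).
  split=> // v; rewrite -/(qf _ _) leNgt; apply/negP; rewrite qfD qfZ => neg.
  have qH := H0 v; rewrite -/(qf _ _) in qH.
  (* With this margin, any [s < inf S + e] leaves the form at [v] negative. *)
  set e := - (qf X v + inf S * qf H v) / (qf H v + 1).
  have e0 : 0 < e by rewrite divr_gt0 ?oppr_gt0 //; lra.
  have [s [s1 [_ /(_ v)]]] := inf_approx hS e0; rewrite -/(qf _ _) qfD qfZ => q1 s2.
  have : e * (qf H v + 1) = - (qf X v + inf S * qf H v) by rewrite /e divfK // gt_eqF //; lra.
  by nra.
have [sp|sn] := ltP 0 (inf S); last first.
  have sz : inf S = 0 by apply/eqP; rewrite eq_le sn s0.
  by move: Y0; rewrite sz scale0r addr0.
have Yp : pdmx (X + inf S *: H).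
  apply: (@lyap_psd_pd _ A) => //; split; first by rewrite trmx_opp lyap_sym.
  move=> v v0; rewrite -/(qf _ _) lyapD lyapZ opprD qfD qfN qfN qfZ.
  have := (proj2 LX) v; have := (proj2 LH) v v0; rewrite -!/(qf _ _) !qfN => h1 h2.
  by nra.
have [d d0 Yd] := pd_ge Yp.
(* The step back keeps [s] nonnegative and costs at most the margin [d]. *)
pose e := Num.min (inf S) (d / (l1 H + 1)).
have lH := l1_ge0 H.
have e0 : 0 < e by rewrite lt_min sp divr_gt0 //; lra.
have eS : e <= inf S by rewrite ge_min lexx.
have ed : e * (l1 H + 1) <= d by rewrite -ler_pdivlMr ?ge_min ?lexx ?orbT //; lra.
suff : inf S <= inf S - e by lra.
apply: ge_inf; first by exists 0 => s [].
split; first by lra.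
have -> : X + (inf S - e) *: H = (X + inf S *: H - d *: 1%:M)
   + (e *: (l1 H *: 1%:M - H) + (d - e * l1 H) *: 1%:M).
  by apply/matrixP => ? ?; rewrite ?(addmxE, oppmxE, scalemxE); ring.
apply: psdD => //; apply: psdD.
  by apply: psdZ; [exact: ltW | exact: psd_le_l1].
by apply: psdZ; [lra | exact: psd1].
Qed.

(** On vectorized matrices [lyap A] is a square matrix, injective by [sylvester0], hence
    invertible. *)
Lemma lyap_surj m (A W : 'M[R]_m) : hurwitz A -> exists X, lyap A X = W.
Proof.
move=> hA; pose M := lin_mulmx A^T + lin_mulmxr A : 'M[R]_(m * m).
have ME (X : 'M[R]_m) : mxvec X *m M = mxvec (lyap A X).
  by rewrite mulmxDr !mul_vec_lin -linearD.
have Mu : M \in unitmx.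
  rewrite -row_free_unit -kermx_eq0; apply: contraT => /rowV0Pn[u].
  move=> /sub_kermxP; rewrite -(vec_mxK u) ME => /(congr1 vec_mx).
  rewrite mxvecK linear0 => u1; rewrite (@sylvester0 _ _ A A (vec_mx u)) ?linear0 ?eqxx //.
  by move=> al be a b e; apply/ltW; move: al be a b e; apply/hurwitzP.
exists (vec_mx (mxvec W *m invmx M)); apply: (can_inj mxvecK).
by rewrite -ME vec_mxK mulmxKV.
Qed.

Lemma lyap_inj m (A X : 'M[R]_m) : hurwitz A -> lyap A X = 0 -> X = 0.
Proof.
move=> hA; apply: sylvester0 => // al be a b e.
by apply/ltW; move: al be a b e; apply/hurwitzP.
Qed.

Lemma lyap_surj_sym m (A W : 'M[R]_m) : hurwitz A -> W^T = W ->
  exists2 X, X^T = X & lyap A X = W.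
Proof.
move=> hA WT; have [X XW] := lyap_surj W hA; exists X => //.
apply/eqP; rewrite -subr_eq0; apply/eqP; apply: (lyap_inj hA).
rewrite lyapD lyapN XW.
have -> : lyap A X^T = (lyap A X)^T by rewrite /lyap trmx_add !trmx_mul trmxK addrC.
by rewrite XW WT subrr.
Qed.

Lemma hurwitz_shift m (A : 'M[R]_m) t : 0 <= t -> hurwitz A -> hurwitz (A - t *: 1%:M).
Proof.
move=> t0 /hurwitzP hA; apply/hurwitzP => al be a b [Aa Ab ab].
suff : al + t < 0 by lra.
apply: (hA _ be a b); split => //.
  rewrite -[A](subrK (t *: 1%:M)) mulmxDl Aa -scalemxAl mul1mx scalerDl.
  by rewrite -!addrA [- _ + _]addrC.
rewrite -[A](subrK (t *: 1%:M)) mulmxDl Ab -scalemxAl mul1mx scalerDl.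
by rewrite addrA.
Qed.

Lemma pd1 m : pdmx (1%:M : 'M[R]_m).
Proof. by split; [rewrite trmx1 | move=> v; exact: qf1_gt0]. Qed.

Lemma id_sub_psd m (X : 'M[R]_m) t : X^T = X -> 0 <= t -> t * l1 X <= 1 ->
  psdmx (1%:M - t *: X).
Proof.
move=> XT t0 tX.
have -> : 1%:M - t *: X = t *: (l1 X *: 1%:M - X) + (1 - t * l1 X) *: 1%:M.
  by apply/matrixP => ? ?; rewrite ?(addmxE, oppmxE, scalemxE); ring.
by apply: psdD; apply: psdZ; rewrite ?subr_ge0 //; [exact: psd_le_l1|exact: psd1].
Qed.

Lemma id_sub_pd m (X : 'M[R]_m) t : X^T = X -> 0 <= t -> t * l1 X <= 1 / 2 ->
  pdmx (1%:M - t *: X).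
Proof.
move=> XT t0 tX; apply: (@psd_shift_pd _ _ _ (1 / 2)); first by lra.
have -> : 1%:M - t *: X - (1 / 2) *: 1%:M = (1 / 2) *: (1%:M - (2 * t) *: X).
  by apply/matrixP => ? ?; rewrite ?(addmxE, oppmxE, scalemxE); field.
by apply: psdZ; [lra | apply: id_sub_psd => //; lra].
Qed.

(* Decrease [t] from a large value to 0 in [A - t I]: the solution [X] of the
   Lyapunov equation at the infimum [t0] is a supersolution for [t] slightly
   above [t0], where positivity is already known, so no limit is needed. *)
Lemma hurwitz_lyap m (A : 'M[R]_m) : hurwitz A ->
  exists2 H, pdmx H & pdmx (- lyap A H).
Proof.
move=> hA; pose At t := A - t *: 1%:M.
pose T : set R := [set t | 0 <= t /\ exists2 H, pdmx H & pdmx (- lyap (At t) H)].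
have hT : has_inf T.
  split; last by exists 0 => s [].
  have lA := l1_ge0 (A^T + A).
  exists (l1 (A^T + A) + 1); split; first by lra.
  exists 1%:M; first exact: pd1.
  apply: (@psd_shift_pd _ _ _ 1) => //.
  have -> : - lyap (At (l1 (A^T + A) + 1)) 1%:M - 1 *: 1%:M
    = (l1 (A^T + A) *: 1%:M - (A^T + A)) + (l1 (A^T + A) + 1) *: 1%:M.
    by rewrite /lyap /At; mxring.
  apply: psdD; first by apply: psd_le_l1; rewrite trmx_add trmxK addrC.
  by apply: psdZ; [lra | exact: psd1].
have t0 : 0 <= inf T by apply: lb_le_inf; [case: hT | move=> s []].
have hAt : hurwitz (At (inf T)) by exact: hurwitz_shift.
have [X XT XL] : exists2 X, X^T = X & lyap (At (inf T)) X = - 1%:M.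
  by apply: lyap_surj_sym => //; rewrite trmx_opp trmx1.
have lX := l1_ge0 X.
have Lt t : - lyap (At t) X = 1%:M - (2 * (inf T - t)) *: X.
  rewrite (lyap_shift _ _ t (inf T)) -/(At _) XL.
  by apply/matrixP => ? ?; rewrite ?(addmxE, oppmxE, scalemxE); ring.
have Xp : psdmx X.
  (* For [t] within this distance above the infimum, [X] still satisfies the Lyapunov inequality of
     [At t]. *)
  have e0 : 0 < (2 * l1 X + 1)^-1 by rewrite invr_gt0; lra.
  have [t [t1 [H Hp LH]] t2] := inf_approx hT e0.
  have it : inf T <= t by apply: ge_inf; [exists 0 => s [] | split => //; exists H].
  apply: (lyap_pos_cert Hp LH XT); rewrite Lt.
  have -> : 1%:M - (2 * (inf T - t)) *: X = 1%:M - (2 * (t - inf T)) *: (- X).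
    by apply/matrixP => ? ?; rewrite ?(addmxE, oppmxE, scalemxE); ring.
  apply: id_sub_psd; rewrite ?trmx_opp ?XT // ?l1N; first by lra.
  have : (t - inf T) * (2 * l1 X + 1) <= 1.
    by rewrite -ler_pdivlMr ?mul1r; lra.
  by nra.
have Xpd : pdmx X.
  by apply: (@lyap_psd_pd _ (At (inf T))) => //; rewrite XL opprK; exact: pd1.
have [tp|tn] := ltP 0 (inf T); last first.
  have tz : inf T = 0 by apply/eqP; rewrite eq_le tn t0.
  exists X => //; move: XL; rewrite tz /At scale0r subr0 => ->.
  by rewrite opprK; exact: pd1.
(* This step back keeps [2 e X <= I / 2], so [X] itself certifies a smaller [t]. *)
pose e := Num.min (inf T) (1 / (4 * l1 X + 1)).
have e0 : 0 < e by rewrite lt_min tp divr_gt0 //; lra.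
have eT : e <= inf T by rewrite ge_min lexx.
have ed : e * (4 * l1 X + 1) <= 1 by rewrite -ler_pdivlMr ?ge_min ?lexx ?orbT //; lra.
suff : inf T <= inf T - e by lra.
apply: ge_inf; first by exists 0 => s [].
split; first by lra.
exists X => //; rewrite Lt; apply: id_sub_pd => //; first by lra.
by nra.
Qed.

Lemma lyap_pos m (A X : 'M[R]_m) : hurwitz A -> X^T = X ->
  psdmx (- lyap A X) -> psdmx X.
Proof. by move=> /hurwitz_lyap[H Hp LH]; exact: lyap_pos_cert LH. Qed.

End Lyapunov.
(** * Limits of matrices *)

Section MatrixLimits.
Variable R : realType.

Definition mcvg m n (u : nat -> 'M[R]_(m, n)) (X : 'M[R]_(m, n)) : Prop :=
  forall i j, u k i j @[k --> \oo] --> X i j.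

Lemma mcvg_cst m n (X : 'M[R]_(m, n)) : mcvg (fun=> X) X.
Proof. by move=> i j; exact: cvg_cst. Qed.
Arguments mcvg_cst {m n} X.

Lemma mcvgD m n (u v : nat -> 'M[R]_(m, n)) X Y :
  mcvg u X -> mcvg v Y -> mcvg (fun k => u k + v k) (X + Y).
Proof.
move=> uX vY i j; rewrite addmxE; under eq_fun do rewrite addmxE.
by apply: cvgD; [exact: uX | exact: vY].
Qed.

Lemma mcvgN m n (u : nat -> 'M[R]_(m, n)) X : mcvg u X -> mcvg (fun k => - u k) (- X).
Proof.
move=> uX i j; rewrite oppmxE; under eq_fun do rewrite oppmxE.
by apply: cvgN; exact: uX.
Qed.

Lemma mcvgB m n (u v : nat -> 'M[R]_(m, n)) X Y :
  mcvg u X -> mcvg v Y -> mcvg (fun k => u k - v k) (X - Y).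
Proof. by move=> uX vY; apply: mcvgD => //; exact: mcvgN. Qed.

Lemma mcvg_tr m n (u : nat -> 'M[R]_(m, n)) X :
  mcvg u X -> mcvg (fun k => (u k)^T) X^T.
Proof. by move=> uX i j; rewrite mxE; under eq_fun do rewrite mxE; exact: uX. Qed.

Lemma cvg_sum_nat (I : Type) (r : seq I) (f : I -> nat -> R) (l : I -> R) :
  (forall i, f i k @[k --> \oo] --> l i) ->
  (\sum_(i <- r) f i k) @[k --> \oo] --> \sum_(i <- r) l i.
Proof.
move=> fl; elim: r => [|i r IH].
  by rewrite big_nil; under eq_fun do rewrite big_nil; exact: cvg_cst.
by rewrite big_cons; under eq_fun do rewrite big_cons; apply: cvgD.
Qed.

Lemma mcvgM m n p (u : nat -> 'M[R]_(m, n)) (v : nat -> 'M[R]_(n, p)) X Y :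
  mcvg u X -> mcvg v Y -> mcvg (fun k => u k *m v k) (X *m Y).
Proof.
move=> uX vY i j; rewrite mxE; under eq_fun do rewrite mxE.
by apply: cvg_sum_nat => k; apply: cvgM; [exact: uX | exact: vY].
Qed.

Lemma mcvg_shift m n (u : nat -> 'M[R]_(m, n)) X :
  mcvg u X -> mcvg (fun k => u k.+1) X.
Proof. by move=> uX i j; rewrite (cvg_shiftS (fun k => u k i j)); exact: uX. Qed.

Lemma mcvg_unique m n (u : nat -> 'M[R]_(m, n)) X Y : mcvg u X -> mcvg u Y -> X = Y.
Proof.
move=> uX uY; apply/matrixP => i j.
by have := uX i j; have := uY i j => /cvg_lim <- // /cvg_lim <-.
Qed.

Lemma mcvg_sym m (u : nat -> 'M[R]_m) X :
  mcvg u X -> (forall k, (u k)^T = u k) -> X^T = X.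
Proof.
move=> uX us; apply: (mcvg_unique _ uX); have := mcvg_tr uX.
by have -> : (fun k => (u k)^T) = u by apply/funext.
Qed.

Lemma mcvg_psd m (u : nat -> 'M[R]_m) X :
  mcvg u X -> (forall k, psdmx (u k)) -> psdmx X.
Proof.
move=> uX up; split; first by apply: (mcvg_sym uX) => k; case: (up k).
move=> v; have qc : (v^T *m u k *m v) 0 0 @[k --> \oo] --> (v^T *m X *m v) 0 0.
  exact: (mcvgM (mcvgM (mcvg_cst v^T) uX) (mcvg_cst v)).
have <- := cvg_lim (@Rhausdorff R) qc; apply: limr_ge.
  by apply/cvg_ex; eexists; exact: qc.
by apply: nearW => k; exact: (proj2 (up k)).
Qed.

Lemma mcvg_mxtrace m (u : nat -> 'M[R]_m) X :
  mcvg u X -> \tr (u k) @[k --> \oo] --> \tr X.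
Proof. by move=> uX; apply: cvg_sum_nat => i; exact: uX. Qed.

Lemma mcvg_l1 m n (u : nat -> 'M[R]_(m, n)) X :
  mcvg u X -> l1 (u k - X) @[k --> \oo] --> (0 : R).
Proof.
move=> uX; have -> : 0 = l1 (X - X) :> R.
  by rewrite subrr /l1 big1 // => i _; rewrite big1 // => j _; rewrite mxE normr0.
apply: cvg_sum_nat => i; apply: cvg_sum_nat => j; apply: cvg_norm.
exact: (mcvgB uX (mcvg_cst X)).
Qed.

Lemma mcvg_near m n (u : nat -> 'M[R]_(m, n)) X eps : mcvg u X -> 0 < eps ->
  exists k0, forall k, (k0 <= k)%N -> l1 (u k - X) <= eps.
Proof.
move=> /mcvg_l1/cvgrPdist_le h /h[k0 _ hk]; exists k0 => k kk.
by have := hk k kk; rewrite /= sub0r normrN ger0_norm ?l1_ge0.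
Qed.

(** Every quadratic form is monotone and bounded, hence convergent; polarization recovers the
    entries. *)
Lemma monotone_mcvg m (u : nat -> 'M[R]_m) (Y : 'M[R]_m) :
  (forall k, (u k)^T = u k) -> (forall k, psdmx (u k.+1 - u k)) ->
  (forall k, psdmx (Y - u k)) ->
  exists2 X, mcvg u X & forall k, psdmx (X - u k).
Proof.
move=> us umono uY.
have mono k l : (k <= l)%N -> psdmx (u l - u k).
  move=> /subnK <-; elim: (l - k)%N => [|i IH]; first exact: psd_subrr.
  by rewrite addSn; apply: psd_le_trans IH (umono _).
have qcvg v : cvgn (fun k => qf (u k) v).
  apply: nondecreasing_is_cvgn.
    by move=> k l /mono[_ /(_ v)]; rewrite -/(qf _ _) qfB subr_ge0.
  exists (qf Y v) => _ [k _ <-].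
  by have [_ /(_ v)] := uY k; rewrite -/(qf _ _) qfB subr_ge0.
have pol k i j : u k i j = 2^-1 * (qf (u k) (delta_mx i 0 + delta_mx j 0)
    - qf (u k) (delta_mx i 0) - qf (u k) (delta_mx j 0)).
  rewrite !qfE bfDl !bfDr !bf_delta.
  have -> : u k j i = u k i j by rewrite -[in RHS]us mxE.
  by field.
have ecvg i j : cvgn (fun k => u k i j).
  under eq_fun do rewrite pol.
  by apply: is_cvgMr; apply: is_cvgB => //; exact: is_cvgB.
pose X : 'M[R]_m := \matrix_(i, j) limn (fun k => u k i j).
have uX : mcvg u X by move=> i j; rewrite mxE; exact: ecvg.
exists X => // k.
have : mcvg (fun l => u (l + k)%N - u k) (X - u k).
  apply: mcvgB (mcvg_cst _) => i j.
  by rewrite (cvg_shiftn k (fun l => u l i j)); exact: uX.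
by move/mcvg_psd; apply => l; apply: mono; rewrite leq_addl.
Qed.

Lemma mcvg_topology m n (u : nat -> 'M[R]_(m, n)) X : mcvg u X -> u k @[k --> \oo] --> X.
Proof.
move=> uX; apply/cvg_ballP => e e0.
have [k0 h] := mcvg_near uX (divr_gt0 e0 (ltr0n R 2)).
exists k0 => // k /h le; split=> // i j; rewrite /ball /= distrC.
have := le_trans (l1_entry (u k - X) i j) le; rewrite addmxE oppmxE; lra.
Qed.

End MatrixLimits.
Arguments mcvg_cst {R m n} X.
(** * Riccati equations *)

Section Riccati.
Variable R : realType.

(** The bounded real Riccati operator: in the application [F] is the closed loop, [Q] its state
    weight and [G] is [gamma^-2 D D^T]. *)
Definition ric m (F Q G P : 'M[R]_m) : 'M[R]_m := lyap F P + Q + P *m G *m P.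

(** The operator is quadratic, so this second-order expansion is exact; the derivative at [P] is the
    Lyapunov operator of [F + G P]. *)
Lemma ricD m (F Q G P X : 'M[R]_m) : P^T = P -> G^T = G ->
  ric F Q G (P + X) = ric F Q G P + lyap (F + G *m P) X + X *m G *m X.
Proof. by move=> PT GT; rewrite /ric /lyap; mxexpand; rewrite PT GT; mxring. Qed.

Lemma ric_sym m (F Q G P : 'M[R]_m) : Q^T = Q -> G^T = G -> P^T = P ->
  (ric F Q G P)^T = ric F Q G P.
Proof.
by move=> QT GT PT; rewrite /ric 2!trmx_add lyap_sym // !trmx_mul QT GT PT mulmxA.
Qed.

Lemma lyap_ricB m (F Q G P Y : 'M[R]_m) : P^T = P -> G^T = G ->
  lyap (F + G *m P) (Y - P)
  = ric F Q G Y - ric F Q G P - (Y - P) *m G *m (Y - P).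
Proof.
move=> PT GT; have := ricD F Q (Y - P) PT GT; rewrite [P + _]addrC subrK => ->.
by apply/matrixP => ? ?; rewrite ?(addmxE, oppmxE, scalemxE); ring.
Qed.

Lemma qf_conj_sym m (X G : 'M[R]_m) v : X^T = X -> qf (X *m G *m X) v = qf G (X *m v).
Proof. by move=> XT; rewrite -{1}XT qf_congr. Qed.

Lemma eigpair_congr m (A A' : 'M[R]_m) al be a b :
  A *m a = A' *m a -> A *m b = A' *m b -> eigpair A al be a b -> eigpair A' al be a b.
Proof. by move=> Aa Ab [ha hb ab]; split=> //; rewrite -?Aa -?Ab. Qed.

(** The residual [W] of a supersolution is only semidefinite, so it gives no information on an
    eigenvector in its kernel; stability is required there. The condition is vacuous for definite
    [W]. *)
Definition stable_on_kernel m (A W : 'M[R]_m) : Prop := forall al be a b,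
  eigpair A al be a b -> W *m a = 0 -> W *m b = 0 -> al < 0.

(** Test the Lyapunov identity for [Y - P] on an eigenvector [v] with nonnegative real part: the
    right side is a sum of nonpositive terms, so all vanish. Then [G (Y - P) v = 0], so [v] is an
    eigenvector of [F + G Y] in the kernel of the residual, which [stable_on_kernel] excludes. *)
Lemma ric_super_hurwitz m (F Q G P Y : 'M[R]_m) : psdmx G -> P^T = P ->
  psdmx (ric F Q G P) -> psdmx (Y - P) -> psdmx (- ric F Q G Y) ->
  stable_on_kernel (F + G *m Y) (ric F Q G Y) -> hurwitz (F + G *m P).
Proof.
move=> Gp PT rP XP rY H; have [GT G0] := Gp; have [XT X0] := XP.
apply/hurwitzP => al be a b e; rewrite ltNge; apply/negP => al0.
have := lyap_eigpair XT e; rewrite -/(lyap _ _) (lyap_ricB F Q _ PT GT).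
rewrite !(qfB (_ - ric _ _ _ _)) !(qfB (ric _ _ _ _)) !qf_conj_sym //.
have := X0 a; have := X0 b; have := (proj2 rP) a; have := (proj2 rP) b.
have := (proj2 rY) a; have := (proj2 rY) b.
have := G0 ((Y - P) *m a); have := G0 ((Y - P) *m b).
rewrite -!/(qf _ _) !qfN => g1 g2 y1 y2 p1 p2 x1 x2 E.
have x3 : 0 <= 2 * al * (qf (Y - P) a + qf (Y - P) b).
  by apply: mulr_ge0; [lra | lra].
have rY0 v : qf (ric F Q G Y) v = 0 -> ric F Q G Y *m v = 0.
  move=> q0; apply/eqP; rewrite -oppr_eq0 -mulNmx; apply/eqP/psd_qf0 => //.
  by rewrite qfN q0 oppr0.
have GX v : qf G ((Y - P) *m v) = 0 -> (F + G *m P) *m v = (F + G *m Y) *m v.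
  move=> /(psd_qf0 Gp) q0; apply/eqP; rewrite eq_sym -subr_eq0 -mulmxBl.
  by rewrite opprD addrACA subrr add0r -mulmxBr -mulmxA q0.
suff : al < 0 by lra.
by apply: (H al be a b); [apply: eigpair_congr e; apply: GX; lra
  | apply: rY0; lra | apply: rY0; lra].
Qed.

(** The Lyapunov operator of the Hurwitz [F + G P] sends [Y - P] to
    [ric Y - (Y - P) G (Y - P) <= 0]. *)
Lemma ric_le m (F Q G P Y : 'M[R]_m) : psdmx G -> P^T = P -> Y^T = Y ->
  ric F Q G P = 0 -> hurwitz (F + G *m P) -> psdmx (- ric F Q G Y) ->
  psdmx (Y - P).
Proof.
move=> Gp PT YT rP hA rY; have GT := proj1 Gp.
have XT : (Y - P)^T = Y - P by rewrite trmx_add trmx_opp YT PT.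
apply: (lyap_pos hA XT); rewrite (lyap_ricB F Q _ PT GT) rP subr0 opprD opprK.
by apply: psdD => //; rewrite -{1}XT; exact: psd_congr.
Qed.

Lemma ric_psd m (F Q G P : 'M[R]_m) : hurwitz F -> psdmx Q -> psdmx G ->
  P^T = P -> ric F Q G P = 0 -> psdmx P.
Proof.
move=> hF Qp Gp PT rP; apply: (lyap_pos hF PT).
have -> : - lyap F P = Q + P *m G *m P.
  by apply/eqP; rewrite eqr_oppLR -subr_eq0 opprK addrA -/(ric F Q G P) rP.
by apply: psdD => //; rewrite -{1}PT; exact: psd_congr.
Qed.

Lemma mcvg_ric m (F : 'M[R]_m) (q g u : nat -> 'M[R]_m) Q G P :
  mcvg q Q -> mcvg g G -> mcvg u P ->
  mcvg (fun k => ric F (q k) (g k) (u k)) (ric F Q G P).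
Proof.
move=> qQ gG uP; apply: mcvgD; last exact: mcvgM (mcvgM uP gG) uP.
apply: mcvgD => //; apply: mcvgD.
  exact (mcvgM (mcvg_cst F^T) uP).
exact (mcvgM uP (mcvg_cst F)).
Qed.

(* Newton's method started at 0: the iterates increase and stay below any
   supersolution [Y], which keeps [F + G P_k] Hurwitz. *)
Lemma ric_exists m (F Q G Y : 'M[R]_m) : hurwitz F -> Q^T = Q -> psdmx G ->
  Y^T = Y -> psdmx (- ric F Q G Y) -> stable_on_kernel (F + G *m Y) (ric F Q G Y) ->
  exists P, [/\ P^T = P, ric F Q G P = 0, hurwitz (F + G *m P) & psdmx (Y - P)].
Proof.
move=> hF QT Gp YT rY H; have GT := proj1 Gp.
pose inv P := [/\ P^T = P, psdmx (ric F Q G P) & psdmx (Y - P)].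
have newton P : inv P -> exists P', [/\ inv P', psdmx (P' - P)
    & ric F Q G P' = (P' - P) *m G *m (P' - P)].
  move=> [PT rP YP]; have hA := ric_super_hurwitz Gp PT rP YP rY H.
  have rPT : (- ric F Q G P)^T = - ric F Q G P by rewrite trmx_opp ric_sym.
  (* Newton step: [X] cancels the linear part of the residual, leaving the nonnegative [X G X]. *)
  have [X XT XL] := lyap_surj_sym hA rPT.
  have rX : ric F Q G (P + X) = X *m G *m X by rewrite ricD // XL subrr add0r.
  have PXT : (P + X)^T = P + X by rewrite trmx_add PT XT.
  exists (P + X); rewrite [P + X - P]addrAC subrr add0r; split=> //; last first.
    by apply: (lyap_pos hA XT); rewrite XL opprK.
  split=> //; first by rewrite rX -{1}XT; exact: psd_congr.
  have eT : (Y - (P + X))^T = Y - (P + X) by rewrite trmx_add trmx_opp YT PXT.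
  apply: (lyap_pos hA eT).
  have -> : - lyap (F + G *m P) (Y - (P + X))
      = - ric F Q G Y + (Y - P) *m G *m (Y - P).
    rewrite (_ : Y - (P + X) = (Y - P) - X); last by rewrite opprD addrA.
    rewrite (lyapD _ (Y - P)) lyapN XL (lyap_ricB F Q _ PT GT).
    by apply/matrixP => ? ?; rewrite ?(addmxE, oppmxE, scalemxE); ring.
  by apply: psdD => //; rewrite -{1}(proj1 YP); exact: psd_congr.
have [P0 P0i] : exists P, inv P.
  have mQT : (- Q)^T = - Q by rewrite trmx_opp QT.
  have [P PT PL] := lyap_surj_sym hF mQT.
  exists P; split=> //.
    by rewrite /ric PL addNr add0r -{1}PT; exact: psd_congr.
  have eT : (Y - P)^T = Y - P by rewrite trmx_add trmx_opp YT PT.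
  apply: (lyap_pos hF eT).
  have -> : - lyap F (Y - P) = - ric F Q G Y + Y *m G *m Y.
    rewrite lyapD lyapN PL /ric.
    by apply/matrixP => ? ?; rewrite ?(addmxE, oppmxE, scalemxE); ring.
  by apply: psdD => //; rewrite -{1}YT; exact: psd_congr.
have /boolp.choice[f fP] (p : {P | inv P}) : exists q : {P | inv P},
    psdmx (sval q - sval p)
    /\ ric F Q G (sval q) = (sval q - sval p) *m G *m (sval q - sval p).
  case: p => P Pi; have [P' [Pi' h1 h2]] := newton P Pi.
  by exists (exist _ P' Pi').
pose u k := sval (iter k f (exist _ P0 P0i)).
have uinv k : inv (u k) by exact: (svalP (iter k f (exist _ P0 P0i))).
have [P uP PY] : exists2 P, mcvg u P & forall k, psdmx (P - u k).
  apply: (@monotone_mcvg _ _ _ Y) => k; try by case: (uinv k).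
  by have [] := fP (iter k f (exist _ P0 P0i)).
have PT : P^T = P by apply: (mcvg_sym uP) => k; case: (uinv k).
have YP : psdmx (Y - P).
  by apply: (mcvg_psd (mcvgB (mcvg_cst Y) uP)) => k; case: (uinv k).
(* The residual is quadratic in the increments, which tend to 0. *)
have rP : ric F Q G P = 0.
  have h1 := mcvg_shift (mcvg_ric (F := F) (mcvg_cst Q) (mcvg_cst G) uP).
  have dP := mcvgB (mcvg_shift uP) uP; rewrite subrr in dP.
  have h2 := mcvgM (mcvgM dP (mcvg_cst G)) dP; rewrite mulmx0 in h2.
  apply: (mcvg_unique h1).
  have -> // : (fun k => ric F Q G (u k.+1))
    = (fun k => (u k.+1 - u k) *m G *m (u k.+1 - u k)).
  by apply/funext => k; have [] := fP (iter k f (exist _ P0 P0i)).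
have rPp : psdmx (ric F Q G P) by rewrite rP; exact: psd0.
exact: ex_intro _ P (And4 PT rP (ric_super_hurwitz Gp PT rPp YP rY H) YP).
Qed.

Lemma hurwitzN1 m : hurwitz (- 1%:M : 'M[R]_m).
Proof.
apply: (@lyap_pd_hurwitz _ _ _ 1%:M); first exact: psd1.
apply: (@psd_shift_pd _ _ _ 1) => //.
have -> : - lyap (- 1%:M) 1%:M - 1 *: 1%:M = 1%:M :> 'M[R]_m.
  by rewrite /lyap; mxring.
exact: psd1.
Qed.

(* [S = I - P] is a square root of [X] iff [P] solves the Riccati equation with
   [F = - I], [Q = I - X] and [G = I]; the identity is a supersolution. *)
Lemma pd_riccati_sqrt m (X : 'M[R]_m) : pdmx X ->
  exists P, [/\ P^T = P, ric (- 1%:M) (1%:M - X) 1%:M P = 0,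
    hurwitz (- 1%:M + 1%:M *m P) & psdmx (1%:M - P)].
Proof.
move=> Xp; have XT := proj1 Xp.
have r1 : ric (- 1%:M) (1%:M - X) 1%:M 1%:M = - X by rewrite /ric /lyap; mxring.
apply: ric_exists; rewrite ?trmx1 ?r1 ?opprK //.
- exact: hurwitzN1.
- by rewrite trmx_add trmx_opp trmx1 XT.
- exact: psd1.
- exact: pd_psd.
move=> al be a b [_ _ ab]; have X0 v : - X *m v = 0 -> v = 0.
  rewrite mulNmx => /eqP; rewrite oppr_eq0 => /eqP Xv.
  by rewrite -(mulKmx (pd_unit Xp) v) Xv mulmx0.
by move=> /X0 a0 /X0 b0; move: ab; rewrite a0 b0 eqxx.
Qed.

(** A possibly singular [X] is shifted by [I / (k + 1)]; as the shift shrinks, the Riccati solutions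
    increase below [I], and their limit gives the root. *)
Lemma psd_sqrt m (X : 'M[R]_m) : psdmx X -> exists S, psdmx S /\ S *m S = X.
Proof.
move=> Xp; have XT := proj1 Xp.
pose Xk k := X + (k.+1%:R^-1 : R) *: 1%:M.
have kp k : 0 < (k.+1%:R^-1 : R) by rewrite invr_gt0 ltr0n.
have Xkp k : pdmx (Xk k).
  by apply: (@psd_shift_pd _ _ _ k.+1%:R^-1) => //; rewrite addrK.
have /boolp.choice[u uP] k := pd_riccati_sqrt (Xkp k).
have [P cP _] : exists2 P, mcvg u P & forall k, psdmx (P - u k).
  apply: (@monotone_mcvg _ _ _ 1%:M) => k; try by case: (uP k).
  have [u1 r1 h1 _] := uP k; have [u2 r2 _ _] := uP k.+1.
  apply: (ric_le (psd1 _ _) u1 u2 r1 h1).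
  have -> : - ric (- 1%:M) (1%:M - Xk k) 1%:M (u k.+1) = Xk k - Xk k.+1.
    rewrite -[LHS]addr0 -r2 /ric.
    by apply/matrixP => ? ?; rewrite ?(addmxE, oppmxE, scalemxE); ring.
  have -> : Xk k - Xk k.+1 = (k.+1%:R^-1 - k.+2%:R^-1) *: 1%:M.
    by apply/matrixP => ? ?; rewrite ?(addmxE, oppmxE, scalemxE); ring.
  apply: psdZ; last exact: psd1.
  by rewrite subr_ge0 lef_pV2 ?posrE ?ltr0n // ler_nat.
have cX : mcvg (fun k => 1%:M - Xk k) (1%:M - X).
  apply: (mcvgB (mcvg_cst _)); rewrite -[X in mcvg _ X]addr0.
  apply: (mcvgD (mcvg_cst _)) => i j; rewrite mxE.
  under eq_fun do rewrite scalemxE.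
  rewrite -(mul0r ((1%:M : 'M[R]_m) i j)); apply: cvgMl.
  exact: cvg_harmonic.
have rP : ric (- 1%:M) (1%:M - X) 1%:M P = 0.
  apply: (mcvg_unique (mcvg_ric (F := - 1%:M) cX (mcvg_cst _) cP)).
  have -> : (fun k => ric (- 1%:M) (1%:M - Xk k) 1%:M (u k)) = fun=> 0.
    by apply/funext => k; have [] := uP k.
  exact: mcvg_cst.
exists (1%:M - P); split.
  by apply: (mcvg_psd (mcvgB (mcvg_cst _) cP)) => k; case: (uP k).
have -> : (1%:M - P) *m (1%:M - P) = ric (- 1%:M) (1%:M - X) 1%:M P + X.
  by rewrite /ric /lyap; mxring.
by rewrite rP add0r.
Qed.

(** With [X = S S], this is the trace of the congruence [S Y S]. *)
Lemma psd_mxtrace_mul m (X Y : 'M[R]_m) : psdmx X -> psdmx Y -> 0 <= \tr (X *m Y).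
Proof.
move=> /psd_sqrt[S [[ST _] <-]] Yp; rewrite -mulmxA mxtrace_mulC -{1}ST.
by apply: psd_tr; exact: psd_congr.
Qed.

(* A small step from [P] along the solution of the closed-loop Lyapunov equation
   gives a strict supersolution, which survives a perturbation of [G]. *)
Lemma ric_perturb m (F Q G G' P : 'M[R]_m) : psdmx G -> psdmx G' -> P^T = P ->
  Q^T = Q -> ric F Q G P = 0 -> hurwitz (F + G *m P) ->
  exists Y eps, [/\ 0 < eps, Y^T = Y & pdmx (- ric F Q (G + eps *: G') Y)].
Proof.
move=> [GT G0] [GT' G0'] PT QT rP hA.
have m1T : (- 1%:M : 'M[R]_m)^T = - 1%:M by rewrite trmx_opp trmx1.
have [Z ZT ZL] := lyap_surj_sym hA m1T.
have lZ := l1_ge0 (Z *m G *m Z); set z := l1 (Z *m G *m Z) in lZ.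
(* The step [t Z] gains [t I]; the losses [t^2 z] and [e y] are each at most [t / 4], leaving a
   margin [t / 2]. *)
pose t := (4 * (z + 1))^-1.
have t0 : 0 < t by rewrite invr_gt0; lra.
have tz : t * (4 * (z + 1)) = 1 by rewrite /t mulVf // gt_eqF //; lra.
pose Y := P + t *: Z.
have YT : Y^T = Y by rewrite trmx_add trmx_scale PT ZT.
have lY := l1_ge0 (Y *m G' *m Y); set y := l1 (Y *m G' *m Y) in lY.
pose e := t / (4 * (y + 1)).
have e0 : 0 < e by rewrite divr_gt0 //; lra.
have ey : e * (4 * (y + 1)) = t by rewrite /e divfK // gt_eqF //; lra.
exists Y, e; split=> //.
apply: (@psd_shift_pd _ _ _ (t / 2)); first by lra.
have -> : - ric F Q (G + e *: G') Y - (t / 2) *: 1%:M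
  = (t * t) *: (z *: 1%:M - Z *m G *m Z) + e *: (y *: 1%:M - Y *m G' *m Y)
    + (t / 2 - t * t * z - e * y) *: 1%:M.
  have -> : ric F Q (G + e *: G') Y = ric F Q G Y + e *: (Y *m G' *m Y).
    by rewrite /ric; mxring.
  rewrite {1}/Y ricD // rP add0r lyapZ ZL.
  by mxexpand; apply/matrixP => ? ?; rewrite ?(addmxE, oppmxE, scalemxE); field.
have c1 : 0 <= t / 2 - t * t * z - e * y.
  have h1 : t * t * z <= t / 4 by nra.
  have h2 : e * y <= t / 4 by nra.
  by lra.
apply: psdD; first apply: psdD.
- apply: psdZ; first by rewrite mulr_ge0 // ltW.
  by apply: psd_le_l1; rewrite !trmx_mul ZT GT mulmxA.
- apply: psdZ; first exact: ltW.
  by apply: psd_le_l1; rewrite !trmx_mul YT GT' mulmxA.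
- by apply: psdZ => //; exact: psd1.
Qed.

End Riccati.
(** * Solvability of the Riccati equation *)

Section BoundedReal.
Variable R : realType.

Definition stab_sol m (F Q G P : 'M[R]_m) : Prop :=
  [/\ psdmx P, ric F Q G P = 0 & hurwitz (F + G *m P)].

Lemma stab_sol_strict m (F Q G Y : 'M[R]_m) : hurwitz F -> psdmx Q -> psdmx G ->
  Y^T = Y -> pdmx (- ric F Q G Y) -> exists P, stab_sol F Q G P.
Proof.
move=> hF Qp Gp YT rY.
have [|P [PT rP hA _]] := ric_exists hF (proj1 Qp) Gp YT (pd_psd rY).
  move=> al be a b [_ _ ab]; have Y0 (v : 'cV[R]_m) : ric F Q G Y *m v = 0 -> v = 0.
    move=> rv; apply/eqP; apply: contraT => /(proj2 rY).
    by rewrite -mulmxA mulNmx rv oppr0 mulmx0 mxE ltxx.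
  by move=> /Y0 a0 /Y0 b0; move: ab; rewrite a0 b0 eqxx.
by exists P; split; [exact: (ric_psd hF Qp Gp PT rP)|exact: rP|exact: hA].
Qed.

(** The equation at [v] gives [kappa |P v|^2 <= - 2 <P v, F v>], hence [kappa |P v| <= 2 |F v|], and
    [v^T P v <= (|v|^2 + |P v|^2) / 2]. The bound depends on [G] only through [kappa], which keeps
    the continuation in [s] from blowing up. *)
Lemma ric_bound m (F Q G P : 'M[R]_m) (kappa : R) : 0 < kappa ->
  psdmx (G - kappa *: 1%:M) -> psdmx Q -> P^T = P -> ric F Q G P = 0 ->
  psdmx ((1 / 2) *: 1%:M + (2 / kappa ^+ 2) *: (F^T *m F) - P).
Proof.
move=> k0 Gk Qp PT rP; split.
  by rewrite !trmx_add !trmx_scale trmx_opp trmx_mul trmxK trmx1 PT.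
move=> v; rewrite -/(qf _ _) qfB qfD !qfZ.
have -> : qf (F^T *m F) v = qf 1%:M (F *m v) by rewrite -qf_congr mulmx1.
have := (proj2 Qp) v; have := (proj2 Gk) (P *m v); rewrite -!/(qf _ _) qfB qfZ => g q.
have PF : qf (lyap F P) v = 2 * bf 1%:M (P *m v) (F *m v).
  rewrite qfD !qfE bf_mull bf_mulr (bf_sym (F *m v)) //.
  have -> : bf P v (F *m v) = bf 1%:M (P *m v) (F *m v) by rewrite -bf_mull PT mulmx1.
  by ring.
have PP : bf 1%:M v (P *m v) = qf P v by rewrite -bf_mulr mul1mx.
have := qf_mx0 v; rewrite -rP /ric 2!qfD PF qf_conj_sym // => r.
have s1 := qf1_ge0 (kappa *: (P *m v) + 2 *: (F *m v)).
have s2 := qf1_ge0 (v - P *m v).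
move: s1 s2; rewrite !qfE !(bfDl, bfDr, bfNl, bfNr, bfZl, bfZr) -!qfE.
rewrite (bf_sym (P *m v) v) ?trmx1 // (bf_sym (F *m v) (P *m v)) ?trmx1 // PP.
set p := qf 1%:M (P *m v) in g *; set f := qf 1%:M (F *m v); set pf := bf _ _ _ in r *.
set x := qf P v in r *; set y := qf 1%:M v => s1 s2.
have h1 : kappa * (kappa * p + 2 * pf) <= 0 by rewrite pmulr_rle0 //; lra.
have h2 : kappa ^+ 2 * p <= 4 * f by nra.
have -> : 2 / kappa ^+ 2 * f = (4 * f) / kappa ^+ 2 / 2 by field; rewrite gt_eqF.
have : p <= (4 * f) / kappa ^+ 2 by rewrite ler_pdivlMr ?exprn_gt0 // mulrC.
by lra.
Qed.

(* The sup [sg] of the [s] for which the Riccati equation with quadratic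
   coefficient [s G] is solvable: solvability is open by [ric_perturb], and at
   [sg] the monotone limit of the solutions is stabilizing unless an imaginary
   eigenvalue appears. *)
Lemma stab_sol_homotopy m (F Q G : 'M[R]_m) (mu : R) : hurwitz F -> psdmx Q -> pdmx G ->
  0 < mu ->
  (forall (s : R) P, 0 < s -> s <= mu -> psdmx P -> ric F Q (s *: G) P = 0 ->
     forall be a b, ~ eigpair (F + s *: G *m P) 0 be a b) ->
  exists P, stab_sol F Q (mu *: G) P.
Proof.
move=> hF Qp Gpd mu0 noim; have Gp := pd_psd Gpd; have [GT G0] := Gp.
have QT := proj1 Qp.
have sGp (s : R) : 0 <= s -> psdmx (s *: G) by move=> ?; exact: psdZ.
have ricZ (s t : R) P : ric F Q (s *: G) P = ric F Q (t *: G) P + (s - t) *: (P *m G *m P).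
  by rewrite /ric; mxring.
pose T (s : R) := 0 <= s /\ exists P, stab_sol F Q (s *: G) P.
(* A solution at [s] is a supersolution at [t <= s]; for [t < s], [G P] vanishes on the kernel of
   its residual, so the closed loop acts there as the Hurwitz [F]. *)
have Tdown s t : T s -> 0 <= t -> t <= s -> T t.
  move=> [s0 [P [Pp rP hA]]] t0 ts; split=> //.
  have [PT _] := Pp.
  have rt : - ric F Q (t *: G) P = (s - t) *: (P *m G *m P).
    by rewrite (ricZ t s) rP add0r -scaleNr opprB.
  have [] := @ric_exists _ _ F Q (t *: G) P hF QT (sGp _ t0) PT.
  - by rewrite rt; apply: psdZ; rewrite ?subr_ge0 // -{1}PT; exact: psd_congr.
  - have [ts'|ts'] := eqVneq t s.
      by move=> al be a b e _ _; move: al be a b e; rewrite ts'; apply/hurwitzP.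
    have st0 : 0 < s - t by rewrite subr_gt0 lt_neqAle ts'.
    have FP (v : 'cV[R]_m) : ric F Q (t *: G) P *m v = 0 -> (F + t *: G *m P) *m v = F *m v.
      move=> /eqP; rewrite -oppr_eq0 -mulNmx rt => /eqP rv.
      have /eqP : (s - t) * qf (P *m G *m P) v = 0.
        by rewrite -qfZ /qf -mulmxA rv mulmx0 mxE.
      rewrite mulf_eq0 gt_eqF //= => /eqP.
      rewrite qf_conj_sym // => /(psd_qf0 Gp) GPv.
      by rewrite mulmxDl -!scalemxAl -mulmxA GPv scaler0 addr0.
    move=> al be a b e ra rb; apply: (proj1 (hurwitzP F) hF al be a b).
    by apply: eigpair_congr e; exact: FP.
  - by move=> P' [PT' rP' hA' _]; exists P'; split;
      [exact: (ric_psd hF Qp (sGp t t0) PT' rP') | exact: rP' | exact: hA'].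
have T0 : T 0.
  split=> //.
  have [|P PT PL] := @lyap_surj_sym _ _ F (- Q) hF; first by rewrite trmx_opp QT.
  have rP : ric F Q (0 *: G) P = 0 by rewrite /ric PL scale0r mulmx0 mul0mx addNr addr0.
  exists P; split; [|exact: rP|by rewrite scale0r mul0mx addr0].
  exact: (ric_psd hF Qp (sGp 0 (lexx 0)) PT rP).
have Topen s : T s -> exists2 t, T t & s < t.
  move=> [s0 [P [Pp rP hA]]].
  have [Y [e [e0 YT rY]]] := ric_perturb (sGp _ s0) Gp (proj1 Pp) QT rP hA.
  rewrite -scalerDl in rY.
  have se0 : 0 <= s + e by lra.
  have [P' P'P] := stab_sol_strict hF Qp (sGp _ se0) YT rY.
  by exists (s + e); [split; [exact: se0 | exists P'; exact: P'P] | lra].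
have TE s : T s = (0 <= s /\ exists P, stab_sol F Q (s *: G) P) by [].
clearbody T.
suff : T mu by rewrite TE => -[].
apply: contrapT => Tmu.
have Tub s : T s -> s <= mu.
  by move=> Ts; rewrite leNgt; apply/negP => /ltW smu; exact: Tmu (Tdown s mu Ts (ltW mu0) smu).
have hT : has_sup T by split; [exists 0 | exists mu => s /Tub].
pose sg := sup T.
have Tsg s : T s -> s <= sg by move=> Ts; apply: ub_le_sup Ts; case: hT.
have sg0 : 0 < sg by have [t /Tsg ts t0] := Topen 0 T0; exact: lt_le_trans ts.
have sgmu : sg <= mu by apply: ge_sup; [exists 0 | move=> s /Tub].
suff [P PP] : exists P, stab_sol F Q (sg *: G) P.
  have [|t /Tsg ts] := Topen sg.
    by rewrite TE; split; [exact: ltW | exists P; exact: PP].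
  by rewrite ltNge ts.
(* Increasing to [sg] while staying above [sg / 2], so that [ric_bound] applies with a single
   [kappa]. *)
pose s k : R := sg * (1 - 2^-1 * k.+1%:R^-1).
have h0 k : 0 < (k.+1%:R^-1 : R) <= 1.
  by rewrite invr_gt0 ltr0n /= invf_le1 ?ltr0n // ler1n.
have s0 k : sg / 2 <= s k.
  rewrite /s; have /andP[_] := h0 k; set h := _^-1 => h1; nra.
have ssg k : s k < sg.
  by rewrite /s gtr_pMr //; have /andP[] := h0 k; lra.
have smono k : s k <= s k.+1.
  rewrite /s ler_pM2l // lerD2l lerN2 ler_pM2l ?invr_gt0 ?ltr0n //.
  by rewrite lef_pV2 ?posrE ?ltr0n // ler_nat.
have sp k : 0 <= s k by apply: le_trans (s0 k); rewrite divr_ge0 // ltW.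
have Ts k : T (s k).
  have e0 : 0 < sg - s k by rewrite subr_gt0.
  have [t Tt] := sup_adherent e0 hT; rewrite -/sg opprB addrC subrK => st.
  by exact: (Tdown t _ Tt (sp k) (ltW st)).
have /boolp.choice[u uP] k : exists P, stab_sol F Q (s k *: G) P.
  by have := Ts k; rewrite TE => -[].
have [kap kap0 Gkap] := pd_ge Gpd.
have kap20 : 0 < sg / 2 * kap by rewrite mulr_gt0 // divr_gt0.
have [P uPc uPle] : exists2 P, mcvg u P & forall k, psdmx (P - u k).
  apply: (@monotone_mcvg _ _ _
    ((1 / 2) *: 1%:M + (2 / (sg / 2 * kap) ^+ 2) *: (F^T *m F))) => k.
  - by have [[]] := uP k.
  - have [[u1 _] r1 a1] := uP k; have [[u2 u20] r2 a2] := uP k.+1.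
    apply: (ric_le (sGp _ (sp k)) u1 u2 r1 a1).
    rewrite (ricZ _ (s k.+1)) r2 add0r -scaleNr opprB; apply: psdZ; first by rewrite subr_ge0.
    by rewrite -{1}u2; exact: psd_congr.
  - have [[u1 _] r1 _] := uP k.
    apply: (ric_bound kap20 _ Qp u1 r1).
    have -> : s k *: G - (sg / 2 * kap) *: 1%:M
      = s k *: (G - kap *: 1%:M) + ((s k - sg / 2) * kap) *: 1%:M.
      by apply/matrixP => ? ?; rewrite ?(addmxE, oppmxE, scalemxE); ring.
    apply: psdD; first exact: psdZ.
    apply: psdZ; last exact: psd1.
    by rewrite mulr_ge0 ?subr_ge0 // ltW.
have cs : s k @[k --> \oo] --> sg.
  rewrite -[X in _ --> X]mulr1 -[X in _ * X]subr0 -[X in _ - X](mulr0 2^-1).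
  apply: cvgMr; apply: cvgB; first exact: cvg_cst.
  by apply: cvgMr; exact: cvg_harmonic.
have csG : mcvg (fun k => s k *: G) (sg *: G).
  by move=> i j; rewrite scalemxE; under eq_fun do rewrite scalemxE; exact: cvgMl.
have rP : ric F Q (sg *: G) P = 0.
  apply: (mcvg_unique (mcvg_ric (F := F) (mcvg_cst Q) csG uPc)).
  have -> : (fun k => ric F Q (s k *: G) (u k)) = fun=> 0.
    by apply/funext => k; have [] := uP k.
  exact: mcvg_cst.
have Pp : psdmx P by apply: (mcvg_psd uPc) => k; have [] := uP k.
have PT := proj1 Pp.
exists P; split; [exact: Pp|exact: rP|apply/hurwitzP => al be a b e].
rewrite ltNge le_eqVlt; apply/negP => /orP[/eqP al0|al0].
  by rewrite -al0 in e; exact: (noim sg P sg0 sgmu Pp rP be a b).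
(* There remains a positive real part [al]. For [u k] close to [P] and [X = P - u k], the term
   [sg X G X] is at most [al X], so every term of the Lyapunov identity vanishes on the eigenvector,
   where [F + sg G P] then acts as the Hurwitz [F]. *)
have c0 : 0 <= sg * l1 G by rewrite mulr_ge0 ?l1_ge0 // ltW.
have eps0 : 0 < al / (sg * l1 G + 1) by rewrite divr_gt0 //; lra.
have [k /(_ k (leqnn k)) lk] := mcvg_near uPc eps0.
have [X XE] : exists X, X = P - u k by exists (P - u k).
have := uPle k; rewrite -XE => Xp; have [XT X0] := Xp.
have trX : sg * l1 G * \tr X <= al.
  have : \tr X <= al / (sg * l1 G + 1).
    apply: le_trans (ler_norm _) (le_trans (l1_mxtrace _) _).
    by rewrite -l1N XE opprB.
  rewrite ler_pdivlMr; last by lra.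
  by have := psd_tr Xp; nra.
have [[ukT uk0] rk _] := uP k.
have LX : lyap (F + sg *: G *m P) X
    = sg *: (X *m G *m X) - (sg - s k) *: (u k *m G *m u k).
  have := lyap_ricB F Q (u k) PT (proj1 (sGp sg (ltW sg0))).
  rewrite rP (ricZ _ (s k)) rk -opprB -XE lyapN => /eqP; rewrite eqr_oppLR => /eqP ->.
  by mxring.
have := lyap_eigpair XT e; rewrite -/(lyap _ _) LX !qfB !qfZ !qf_conj_sym // => E.
have bound (v : 'cV[R]_m) : sg * qf G (X *m v) <= al * qf X v.
  have h1 : qf G (X *m v) <= l1 G * (\tr X * qf X v).
    apply: le_trans (ler_norm _) (le_trans (qf_l1 _ _) _).
    by rewrite ler_wpM2l ?l1_ge0 // psd_mul_sqr.
  apply: (@le_trans _ _ (sg * (l1 G * (\tr X * qf X v)))).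
    by rewrite ler_pM2l.
  by rewrite !mulrA ler_wpM2r // ; exact: X0.
have ba := bound a; have bb := bound b.
have xa := X0 a; have xb := X0 b; rewrite -!/(qf _ _) in xa xb.
have ga := G0 (u k *m a); have gb := G0 (u k *m b); rewrite -!/(qf _ _) in ga gb.
have ds : 0 < sg - s k by rewrite subr_gt0.
have ga' := mulr_ge0 (ltW ds) ga; have gb' := mulr_ge0 (ltW ds) gb.
have qa' := mulr_ge0 (ltW al0) xa; have qb' := mulr_ge0 (ltW al0) xb.
have za : al * qf X a = 0 by lra.
have zb : al * qf X b = 0 by lra.
have wa : (sg - s k) * qf G (u k *m a) = 0 by lra.
have wb : (sg - s k) * qf G (u k *m b) = 0 by lra.
have FP (v : 'cV[R]_m) : al * qf X v = 0 -> (sg - s k) * qf G (u k *m v) = 0 ->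
    (F + sg *: G *m P) *m v = F *m v.
  move=> /eqP; rewrite mulf_eq0 gt_eqF //= => /eqP /(psd_qf0 Xp) Xv.
  move=> /eqP; rewrite mulf_eq0 gt_eqF //= => /eqP /(psd_qf0 Gp) Gv.
  rewrite mulmxDl -!scalemxAl -mulmxA.
  rewrite (_ : P = X + u k); last by rewrite XE subrK.
  by rewrite mulmxDl Xv add0r Gv scaler0 addr0.
have /hurwitzP/(_ al be a b) := hF.
by rewrite ltNge ltW // => /(_ (eigpair_congr (FP a za wa) (FP b zb wb) e)).
Qed.

End BoundedReal.
(** * The frequency response *)

Section TransferFunction.
Variable R : realType.
Local Notation C := R[i].
Local Open Scope sesquilinear_scope.

Lemma ctM p q r (M : 'M[C]_(p, q)) (N : 'M[C]_(q, r)) :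
  (M *m N)^t* = N^t* *m M^t*.
Proof. by rewrite trmx_mul map_mxM. Qed.

Lemma ct_cplxmx p q (M : 'M[R]_(p, q)) : (cplxmx M)^t* = cplxmx M^T.
Proof.
apply/matrixP => i j; rewrite !mxE; apply/eqP.
by rewrite eq_complex /= oppr0 !eqxx.
Qed.

Lemma cm_gram p (a b : 'cV[R]_p) :
  (cm a b)^t* *m cm a b = ((qf 1%:M a + qf 1%:M b)%:C)%C%:M.
Proof.
apply/matrixP => i j; rewrite (ord1 i) (ord1 j) [LHS]mxE [RHS]mxE eqxx mulr1n.
rewrite !qf1E -big_split /= rmorph_sum /=; apply: eq_bigr => k _.
rewrite [_^t* _ _]mxE [_^T _ _]mxE !cmE; apply/eqP.
by rewrite eq_complex /=; apply/andP; split; apply/eqP; ring.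
Qed.

Lemma sqrtmxP m (X : 'M[R]_m) : psdmx X ->
  psdmx (sqrtmx X) /\ sqrtmx X *m sqrtmx X = X.
Proof. by move=> /psd_sqrt h; have := xgetPex 0 h. Qed.

Variables (m n : nat) (F Q : 'M[R]_m) (D : 'M[R]_(m, n)).
Hypothesis hF : hurwitz F.
Hypothesis Qp : psdmx Q.

Definition tf (w : R) : 'M[C]_(m, n) :=
  cplxmx (sqrtmx Q) *m invmx ((0 +i* w)%C%:M - cplxmx F) *m cplxmx D.

Local Notation res w := ((0 +i* w)%C%:M - cplxmx F).

Lemma res_unit w : res w \in unitmx.
Proof. exact: hurwitz_unit. Qed.

Lemma res_cm w (a b : 'cV[R]_m) :
  res w *m cm a b = cm (- w *: b - F *m a) (w *: a - F *m b).
Proof.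
rewrite mulmxBl mul_scalar_mx scale_cm mul_cplxmx_cm cm_opp cm_add /=.
by rewrite !scale0r add0r addr0 scaleNr.
Qed.

(** Real form of a singular pair: input [u = c + i d], state [x = a + i b] with [i w x = F x + D u],
    and output energy [s^2 |u|^2]. *)
Lemma tf_eigen w s : eigenvalue ((tf w)^t* *m tf w) ((s ^+ 2)%:C)%C ->
  exists a b c d, [/\ F *m a + D *m c = - w *: b, F *m b + D *m d = w *: a,
    (c != 0) || (d != 0) &
    qf Q a + qf Q b = s ^+ 2 * (qf 1%:M c + qf 1%:M d)].
Proof.
move=> /eigenvalue_col[u]; rewrite (cm_ReIm u).
set c := map_mx _ u; set d := map_mx _ u => Tu; rewrite cm_eq0 negb_and => u0.
pose x := invmx (res w) *m (cplxmx D *m cm c d).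
have resx : res w *m x = cplxmx D *m cm c d by rewrite mulKVmx ?res_unit.
pose a := map_mx (@complex.Re R) x; pose b := map_mx (@complex.Im R) x.
have xE : x = cm a b by exact: cm_ReIm.
rewrite xE res_cm mul_cplxmx_cm in resx; have [ra rb] := cm_inj resx.
have Tx : tf w *m cm c d = cm (sqrtmx Q *m a) (sqrtmx Q *m b).
  by rewrite -mul_cplxmx_cm -xE /tf !mulmxA.
exists a, b, c, d; split=> //.
- by rewrite -ra addrC subrK.
- by rewrite -rb addrC subrK.
have := cm_gram (sqrtmx Q *m a) (sqrtmx Q *m b).
rewrite -Tx ctM -mulmxA (mulmxA _ (tf w)) Tu -scalemxAr cm_gram.
move=> /matrixP/(_ 0 0); rewrite scalemxE !mxE eqxx !mulr1n -rmorphM /= => -[->].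
have [[ST _] SS] := sqrtmxP Qp.
have qS v : qf Q v = qf 1%:M (sqrtmx Q *m v) by rewrite -qf_congr mulmx1 ST SS.
by rewrite !qS.
Qed.

(** Feed the input [u = s D^T P x] for the eigenvector [x = a + i b]: the state response is [x], the
    Riccati equation reads [Q x = (i w - F)^* P x], so [T^* T u = D^T P x = u / s]. If [u] vanished,
    [x] would be an eigenvector of the Hurwitz [F] on the imaginary axis. *)
Lemma eigen_tf (w s : R) (P : 'M[R]_m) (a b : 'cV[R]_m) : 0 < s -> P^T = P ->
  ric F Q (s *: (D *m D^T)) P = 0 ->
  eigpair (F + s *: (D *m D^T) *m P) 0 w a b ->
  eigenvalue ((tf w)^t* *m tf w) (s^-1%:C)%C.
Proof.
move=> s0 PT rP e; have [Aa Ab ab] := e.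
rewrite !scale0r sub0r in Aa; rewrite !scale0r addr0 in Ab.
pose c := s *: (D^T *m (P *m a)); pose d := s *: (D^T *m (P *m b)).
have FE (v : 'cV[R]_m) : F *m v =
    (F + s *: (D *m D^T) *m P) *m v - D *m (s *: (D^T *m (P *m v))).
  by rewrite mulmxDl -scalemxAr -!scalemxAl -!mulmxA addrK.
have rv : res w *m cm a b = cplxmx D *m cm c d.
  rewrite res_cm mul_cplxmx_cm !FE Aa Ab; congr (cm _ _).
    by rewrite scaleNr opprB addrCA subrr addr0.
  by rewrite opprB addrCA subrr addr0.
have [[ST _] SS] := sqrtmxP Qp.
have Tx : tf w *m cm c d = cplxmx (sqrtmx Q) *m cm a b.
  by rewrite /tf -mulmxA -rv mulmxA mulmxKV ?res_unit.
have QE : cplxmx Q *m cm a b = (res w)^t* *m (cplxmx P *m cm a b).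
  have -> : (res w)^t* = - ((0 +i* w)%C%:M + cplxmx F^T).
    rewrite -ct_cplxmx; apply/matrixP => i j; rewrite !mxE; apply/eqP.
    by rewrite (eq_sym i j); case: (j == i);
      rewrite ?mulr1n ?mulr0n eq_complex /=; apply/andP; split; apply/eqP; ring.
  rewrite mulNmx mulmxDl mul_scalar_mx !mul_cplxmx_cm scale_cm cm_add cm_opp /=.
  have QE v : Q *m v = - (P *m ((F + s *: (D *m D^T) *m P) *m v) + F^T *m (P *m v)).
    apply/eqP; rewrite -addr_eq0 -(mul0mx _ v) -rP /ric /lyap.
    by apply/eqP; mxring.
  rewrite !QE Aa Ab; congr (cm _ _); rewrite !scale0r ?sub0r ?addr0.
    by rewrite mulmxN -scalemxAr.
  by rewrite -scalemxAr.
apply/eigenvalue_col; exists (cm c d).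
  rewrite -mulmxA Tx /tf !ctM !ct_cplxmx ST -!mulmxA (mulmxA (cplxmx (sqrtmx Q))).
  rewrite -cplxmx_mul SS QE (mulmxA _ ((res w)^t*)) -ctM mulmxV ?res_unit //.
  have -> : (1%:M)^t* = 1%:M :> 'M[C]_m by rewrite trmx1 map_mx1.
  rewrite mul1mx !mul_cplxmx_cm scale_cm /= !scale0r subr0 add0r /c /d.
  rewrite !scalerA mulVf ?gt_eqF //.
  by rewrite !scale1r.
rewrite cm_eq0 negb_and; apply: contraT; rewrite negb_or !negbK => /andP[/eqP c0 /eqP d0].
have := FE a; have := FE b; rewrite -/c -/d c0 d0 mulmx0 !subr0 Aa Ab => Fb Fa.
have /hurwitzP/(_ 0 w a b) := hF; rewrite ltxx; apply; split => //.
  by rewrite scale0r sub0r.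
by rewrite scale0r addr0.
Qed.

(** Finiteness of the spectrum makes the [sup] in [sigma_max] an upper bound of its set. *)
Lemma eigenvalue_bounded k (N : 'M[C]_k) :
  has_ubound [set s : R | 0 <= s /\ eigenvalue N ((s ^+ 2)%:C)%C].
Proof.
have [rs crs] := closed_field_poly_normal (char_poly N).
have lc : lead_coef (char_poly N) = 1 by apply: monicP; exact: char_poly_monic.
rewrite lc scale1r in crs.
exists (\sum_(z <- rs) `|complex.Re z| + 1) => s [s0].
rewrite eigenvalue_root_char crs root_prod_XsubC => srs.
have : `|complex.Re ((s ^+ 2)%:C)%C| <= \sum_(z <- rs) `|complex.Re z|.
  rewrite (big_rem _ srs) /= lerDl; exact: sumr_ge0.
rewrite /= ger0_norm ?sqr_ge0 // => h.
by have := sqr_ge0 (s - 1); nra.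
Qed.

Lemma sigma_max_tf_ge (w s : R) (P : 'M[R]_m) (a b : 'cV[R]_m) : 0 < s -> P^T = P ->
  ric F Q (s *: (D *m D^T)) P = 0 ->
  eigpair (F + s *: (D *m D^T) *m P) 0 w a b ->
  Num.sqrt s^-1 <= sigma_max (tf w).
Proof.
move=> s0 PT rP /(eigen_tf s0 PT rP) e; apply: ub_le_sup; first exact: eigenvalue_bounded.
by split; [exact: sqrtr_ge0 | rewrite sqr_sqrtr // invr_ge0 ltW].
Qed.

(** Dissipation argument with storage function [v^T Y v]: summed over real and imaginary parts, the
    storage terms cancel, and completing the square bounds the supply by [|u|^2 / nu]. *)
Lemma sigma_max_tf_le (w nu : R) (Y : 'M[R]_m) : 0 < nu -> Y^T = Y ->
  psdmx (- ric F Q (nu *: (D *m D^T)) Y) -> sigma_max (tf w) <= Num.sqrt nu^-1.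
Proof.
move=> nu0 YT rY; rewrite /sigma_max; set E := [set s | _].
(* An empty set of singular values has [sup] equal to 0. *)
have [->|/set0P E0] := eqVneq E set0; first by rewrite sup0 sqrtr_ge0.
apply: ge_sup => // s [s0 /tf_eigen[a [b [c [d [Fa Fb cd qE]]]]]].
rewrite -(ger0_norm s0) -sqrtr_sqr ler_sqrt ?invr_ge0 ?(ltW nu0) //.
have cd0 : 0 < qf 1%:M c + qf 1%:M d.
  by case/orP: cd => /qf1_gt0 h; [have := qf1_ge0 d | have := qf1_ge0 c]; lra.
have key (v x : 'cV[R]_m) (e : 'cV[R]_n) : F *m v + D *m e = x ->
   qf Q v <= 2 * bf 1%:M (D^T *m (Y *m v)) e - 2 * bf Y v x
     - nu * qf 1%:M (D^T *m (Y *m v)).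
  move=> <-; have := proj2 rY v; rewrite -/(qf _ _) qfN /ric 2!qfD oppr_ge0.
  rewrite qfD !qfE bf_mull bf_mulr (bf_sym (F *m v)) // -!qfE qf_conj_sym // qfZ.
  have -> : qf (D *m D^T) (Y *m v) = qf 1%:M (D^T *m (Y *m v)).
    by rewrite -[in RHS]qf_congr mulmx1 trmxK.
  have -> : bf 1%:M (D^T *m (Y *m v)) e = bf Y v (D *m e).
    by rewrite -[D *m e]mul1mx /bf mulmx1 mul1mx !trmx_mul trmxK YT !mulmxA.
  by rewrite bfDr; lra.
have ka := key _ _ _ Fa; have kb := key _ _ _ Fb.
rewrite !bfZr (bf_sym b a) // in ka kb.
have sq (p e : 'cV[R]_n) : 2 * bf 1%:M p e - nu * qf 1%:M p <= nu^-1 * qf 1%:M e.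
  rewrite -(ler_pM2l nu0) [leRHS]mulrA mulfV ?gt_eqF // mul1r.
  have := qf1_ge0 (nu *: p - e); rewrite !qfE !(bfDl, bfDr, bfNl, bfNr, bfZl, bfZr) -!qfE.
  by rewrite (bf_sym e p) ?trmx1 //; lra.
rewrite -(ler_pM2r cd0) -qE.
have := sq (D^T *m (Y *m a)) c; have := sq (D^T *m (Y *m b)) d; lra.
Qed.

End TransferFunction.
(** * Traces and norms *)

Section TraceBounds.
Variables (R : realType) (m : nat).

Lemma mxtraceN (X : 'M[R]_m) : \tr (- X) = - \tr X.
Proof. exact: raddfN. Qed.

Lemma mxtraceB (X Y : 'M[R]_m) : \tr (X - Y) = \tr X - \tr Y.
Proof. exact: raddfB. Qed.

Lemma mxtrace_lyap_dual (H Sg X : 'M[R]_m) :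
  \tr (Sg *m lyap H X) = \tr (X *m lyap H^T Sg).
Proof.
rewrite /lyap trmxK !mulmxDr !mxtraceD [in RHS]addrC; congr (_ + _).
  by rewrite mulmxA mxtrace_mulC.
by rewrite mxtrace_mulC mulmxA.
Qed.

Lemma lyapBl (Z W X : 'M[R]_m) : lyap (Z - W) X = lyap Z X - lyap W X.
Proof. by rewrite /lyap; mxring. Qed.

Lemma l1_sqr p q (Z : 'M[R]_(p, q)) :
  l1 Z ^+ 2 <= (p * q)%:R ^+ 2 * \tr (Z^T *m Z).
Proof.
have SE : \tr (Z^T *m Z) = \sum_j \sum_i Z i j ^+ 2.
  rewrite /mxtrace; apply: eq_bigr => j _; rewrite mxE; apply: eq_bigr => i _.
  by rewrite mxE expr2.
have S0 : 0 <= \tr (Z^T *m Z) by apply/psd_tr/psd_gram.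
have ent i j : `|Z i j| <= Num.sqrt (\tr (Z^T *m Z)).
  rewrite -sqrtr_sqr ler_sqrt // SE (bigD1 j) //= (bigD1 i) //= -addrA lerDl.
  by rewrite addr_ge0 // sumr_ge0 // => *; rewrite ?sqr_ge0 // sumr_ge0 // => *; rewrite sqr_ge0.
rewrite -[X in _ * X]sqr_sqrtr // -exprMn ler_sqr ?nnegrE ?l1_ge0 ?mulr_ge0 ?sqrtr_ge0 //.
apply: (@le_trans _ _ (\sum_(i < p) \sum_(j < q) Num.sqrt (\tr (Z^T *m Z)))).
  by apply: ler_sum => i _; apply: ler_sum => j _.
by rewrite !sumr_const !card_ord -mulrnA mulnC [leRHS]mulr_natl.
Qed.

Lemma mxtrace_lyap_le (Z Y : 'M[R]_m) : `|\tr (lyap Z Y)| <= 2 * (l1 Z * l1 Y).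
Proof.
apply: (le_trans (l1_mxtrace _)); apply: (le_trans (l1D _ _)).
have := l1M Z^T Y; have := l1M Y Z; rewrite l1_tr (mulrC (l1 Y)); lra.
Qed.

Lemma mxtrace_quad_l1 (Sg X Z : 'M[R]_m) :
  `|\tr (Sg *m (X *m Z *m X))| <= l1 Sg * l1 Z * l1 X ^+ 2.
Proof.
apply: (le_trans (l1_mxtrace _)); apply: (le_trans (l1M _ _)).
rewrite -mulrA ler_wpM2l ?l1_ge0 //; apply: (le_trans (l1M _ _)).
by rewrite expr2 mulrA [l1 Z * _]mulrC ler_wpM2r ?l1_ge0 // l1M.
Qed.

Lemma norm2E k (v : 'cV[R]_k) : norm2 v = Num.sqrt (qf 1%:M v).
Proof. by rewrite /norm2 qf1E. Qed.

Lemma opnorm_ubound p q (N : 'M[R]_(p, q)) :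
  has_ubound [set norm2 (N *m v) | v in [set v : 'cV[R]_q | norm2 v <= 1]].
Proof.
exists (Num.sqrt (l1 (N^T *m N))) => _ [v /= v1 <-]; rewrite norm2E.
rewrite ler_sqrt ?l1_ge0 // -qf_congr mulmx1.
apply: (le_trans (ler_norm _)); apply: (le_trans (qf_l1 _ _)).
by rewrite ler_piMr ?l1_ge0 // -(ler_sqrt _ ler01) sqrtr1 -norm2E.
Qed.

Lemma qf_opnorm k (N : 'M[R]_k) v : qf N v <= opnorm N * qf 1%:M v.
Proof.
have [->|v0] := eqVneq v 0; first by rewrite !qf0 mulr0.
have vp := qf1_gt0 v0; pose s := Num.sqrt (qf 1%:M v).
have sp : 0 < s by rewrite sqrtr_gt0.
have s2 : s ^+ 2 = qf 1%:M v by rewrite sqr_sqrtr // ltW.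
pose u := s^-1 *: v.
have u1 : qf 1%:M u = 1.
  by rewrite qfE bfZl bfZr -qfE -s2; field; rewrite gt_eqF.
have hop : norm2 (N *m u) <= opnorm N.
  apply: ub_le_sup; first exact: opnorm_ubound.
  by exists u => //=; rewrite norm2E u1 sqrtr1.
have vE : v = s *: u by rewrite scalerA divff ?scale1r // gt_eqF.
rewrite [in leLHS]vE qfE bfZl bfZr -qfE mulrA -expr2 s2 mulrC ler_pM2r //.
apply: le_trans hop; apply: (le_trans (ler_norm _)).
rewrite -sqrtr_sqr norm2E ler_sqrt ?qf1_ge0 //.
have := psd_cauchy u (N *m u) (psd1 R k); rewrite u1 mul1r.
by rewrite -bf_mulr mul1mx.
Qed.

(** Moves a rate bound from trace gaps to cost differences, on both sides at once. *)
Lemma le_congr (g : R -> R) (a a' b b' : R) : a = a' -> b = b' -> a' <= g b' -> a <= g b.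
Proof. by move=> -> ->. Qed.

End TraceBounds.

(** * Policy iterations *)

Section ClosedLoop.
Variables (R : realType) (m d l n : nat).
Variables (A : 'M[R]_m) (B : 'M[R]_(m, d)) (C : 'M[R]_(l, m)) (D : 'M[R]_(m, n)).
Variables (Rw : 'M[R]_d) (gamma : R).
Hypothesis hR : pdmx Rw.
Hypothesis hg : 0 < gamma.
Hypothesis hDD : pdmx (D *m D^T).

Local Notation F K := (A - B *m K).
Local Notation Q K := (Qcl C Rw K).
Local Notation G := (gamma ^- 2 *: (D *m D^T)).

Definition gain_stab (K : 'M[R]_(d, m)) (P : 'M[R]_m) : Prop := stab_sol (F K) (Q K) G P.

Lemma Qcl_psd K : psdmx (Q K).
Proof. by apply: psdD; [exact: psd_gram | apply/psd_congr/pd_psd]. Qed.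

Lemma G_psd : psdmx G.
Proof. by apply: psdZ; [rewrite invr_ge0 exprn_ge0 // ltW | exact: pd_psd]. Qed.

Lemma stabilizing_solutionE K P :
  stabilizing_solution A B C D Rw gamma K P <-> gain_stab K P.
Proof.
have e1 : (F K)^T *m P + P *m F K + C^T *m C + K^T *m Rw *m K
        + gamma ^- 2 *: (P *m D *m D^T *m P) = ric (F K) (Q K) G P.
  rewrite /ric /lyap /Qcl -!scalemxAr -!scalemxAl !addrA; congr (_ + _ *: _).
  by rewrite !mulmxA.
have e2 : F K + gamma ^- 2 *: (D *m D^T *m P) = F K + G *m P by rewrite scalemxAl.
by rewrite /stabilizing_solution e1 e2.
Qed.

(** Along the continuation, an imaginary eigenvalue at [s <= gamma^-2] would force a singular value
    of at least [s^(-1/2) >= gamma] at that frequency. *)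
Lemma feasible_stab K : feasible A B C D Rw gamma K -> exists P, gain_stab K P.
Proof.
move=> [hF hinf]; apply: (stab_sol_homotopy hF (Qcl_psd K) hDD).
  by rewrite invr_gt0 exprn_gt0.
move=> s P s0 sg [PT _] rP w a b e.
have h := sigma_max_tf_ge hF (Qcl_psd K) s0 PT rP e.
have gs : gamma <= Num.sqrt s^-1.
  rewrite -[leLHS](ger0_norm (ltW hg)) -sqrtr_sqr ler_sqrt ?invr_ge0 ?(ltW s0) //.
  by rewrite -[leLHS]invrK lef_pV2 ?posrE // invr_gt0 exprn_gt0.
suff : (gamma%:E <= hinf_norm A B C D Rw K)%E by rewrite leNgt hinf.
apply: (@le_trans _ _ (sigma_max (tf (F K) (Q K) D w))%:E).
  by rewrite lee_fin (le_trans gs).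
by apply: ereal_sup_ubound; exists w.
Qed.

(** A strict supersolution survives raising [gamma^-2] to some [nu], and bounds all frequencies by
    [nu^(-1/2) < gamma]; this uniform bound keeps the supremum strictly below [gamma]. *)
Lemma stab_feasible K P : hurwitz (F K) -> gain_stab K P -> feasible A B C D Rw gamma K.
Proof.
move=> hF [[PT _] rP hA]; split=> //.
have [Y [e [e0 YT rY]]] := ric_perturb G_psd (pd_psd hDD) PT (proj1 (Qcl_psd K)) rP hA.
rewrite -scalerDl in rY; set nu := gamma ^- 2 + e in rY.
have g2 : 0 < gamma ^- 2 by rewrite invr_gt0 exprn_gt0.
have nu0 : 0 < nu by rewrite /nu; lra.
apply: (@le_lt_trans _ _ (Num.sqrt nu^-1)%:E).
  apply: ge_ereal_sup => _ [w _ <-]; rewrite lee_fin.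
  exact: (sigma_max_tf_le hF (Qcl_psd K) w nu0 YT (pd_psd rY)).
rewrite lte_fin -[ltRHS](ger0_norm (ltW hg)) -sqrtr_sqr ltr_sqrt ?exprn_gt0 //.
by rewrite -[ltRHS]invrK ltf_pV2 ?posrE // /nu; lra.
Qed.

Definition gain (P : 'M[R]_m) : 'M[R]_(d, m) := invmx Rw *m B^T *m P.

(* [ric] at its minimizing gain [gain P]; [game P = 0] is the algebraic Riccati
   equation of the differential game. *)
Definition game (P : 'M[R]_m) : 'M[R]_m :=
  lyap A P + C^T *m C + P *m (G - B *m invmx Rw *m B^T) *m P.

Lemma RgainE P : Rw *m gain P = B^T *m P.
Proof. by rewrite /gain -!mulmxA mulKVmx ?pd_unit. Qed.

Lemma gainRE P : P^T = P -> (gain P)^T *m Rw = P *m B.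
Proof.
by move=> PT; rewrite -[LHS]trmxK trmx_mul trmxK (proj1 hR) RgainE trmx_mul PT trmxK.
Qed.

Lemma gain_quad P P' : P^T = P ->
  (gain P)^T *m Rw *m gain P' = P *m (B *m invmx Rw *m B^T) *m P'.
Proof. by move=> PT; rewrite gainRE // /gain !mulmxA. Qed.

(** Completing the square in [K] confines the dependence on the gain to its distance from
    [gain P]. *)
Lemma ric_gameE K P : P^T = P ->
  ric (F K) (Q K) G P = game P + (K - gain P)^T *m Rw *m (K - gain P).
Proof.
move=> PT.
have -> : (K - gain P)^T *m Rw *m (K - gain P)
  = K^T *m Rw *m K - K^T *m (Rw *m gain P) - (gain P)^T *m Rw *m K
    + (gain P)^T *m Rw *m gain P by mxring.
rewrite gain_quad // RgainE gainRE // /ric /game /lyap /Qcl.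
by mxring.
Qed.

Lemma game_stab K P : gain_stab K P -> game P = - ((K - gain P)^T *m Rw *m (K - gain P)).
Proof. by move=> [[PT _] rP _]; apply/eqP; rewrite -addr_eq0 -ric_gameE // rP. Qed.

Lemma psd_gramR p (Z : 'M[R]_(d, p)) : psdmx (Z^T *m Rw *m Z).
Proof. exact/psd_congr/pd_psd. Qed.

Lemma qf_gramR0 (Z : 'M[R]_(d, m)) v : qf (Z^T *m Rw *m Z) v = 0 -> Z *m v = 0.
Proof.
rewrite qf_congr => /(psd_qf0 (pd_psd hR)) RZ.
by rewrite -(mulKmx (pd_unit hR) (Z *m v)) RZ mulmx0.
Qed.

(* Both updates read [K' = K - M (K - gain P)], hence
   [K' - gain P = (1 - M) (K - gain P)]. *)
Definition contracting (M : 'M[R]_d) (c : R) : Prop :=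
  psdmx ((1 - c) *: Rw - (1%:M - M)^T *m Rw *m (1%:M - M)).

(** * One policy step *)

Section Step.
Variables (M : 'M[R]_d) (c : R) (K : 'M[R]_(d, m)) (P : 'M[R]_m).
Hypotheses (c0 : 0 < c) (hM : contracting M c) (hP : gain_stab K P).
Local Notation Dl := (K - gain P).
Local Notation K' := (K - M *m Dl).

Lemma ric_step : ric (F K') (Q K') G P
  = - (c *: (Dl^T *m Rw *m Dl)
       + Dl^T *m ((1 - c) *: Rw - (1%:M - M)^T *m Rw *m (1%:M - M)) *m Dl).
Proof.
have [[PT _] rP _] := hP; rewrite ric_gameE // (game_stab hP).
have -> : K - M *m Dl - gain P = (1%:M - M) *m Dl by rewrite mulmxBl mul1mx addrAC.
by move: Dl => L; mxring.
Qed.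

Lemma ric_step_le : psdmx (- ric (F K') (Q K') G P - c *: (Dl^T *m Rw *m Dl)).
Proof. by rewrite ric_step opprK addrAC subrr add0r; apply: psd_congr. Qed.

Lemma step_le : psdmx (- ric (F K') (Q K') G P).
Proof.
rewrite -[X in psdmx X](subrK (c *: (Dl^T *m Rw *m Dl))).
by apply: psdD; [exact: ric_step_le | apply: psdZ; [exact: ltW|exact: psd_gramR]].
Qed.

Lemma step_Dl (v : 'cV[R]_m) : qf (- ric (F K') (Q K') G P) v <= 0 -> Dl *m v = 0.
Proof.
move=> q0; apply: qf_gramR0; apply/eqP; rewrite eq_le.
rewrite [X in _ && X](proj2 (psd_gramR _) v) andbT -(pmulr_rle0 _ c0) -qfZ.
have := proj2 ric_step_le v; rewrite -/(qf _ _) qfB; lra.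
Qed.

Lemma step_F (v : 'cV[R]_m) : Dl *m v = 0 -> F K' *m v = F K *m v.
Proof. by move=> Dv; rewrite mulmxBr opprB addrCA mulmxDl -!mulmxA Dv !mulmx0 add0r. Qed.

(* An unstable eigenvector of the new closed loop lies in the kernel of
   [K - gain P], so it is already one of the old closed loop. *)
Lemma step_hurwitz : hurwitz (F K) -> hurwitz (F K').
Proof.
move=> /hurwitzP hF; have [[PT P0] _ _] := hP.
apply/hurwitzP => al be a b e; rewrite ltNge; apply/negP => al0.
have := lyap_eigpair PT e; rewrite -/(lyap _ _).
have -> : lyap (F K') P = ric (F K') (Q K') G P - Q K' - P *m G *m P.
  by rewrite /ric addrAC addrK addrK.
rewrite !(qfB (_ - Q _)) !(qfB (ric _ _ _ _)) !qf_conj_sym // => E.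
have := proj2 (Qcl_psd K') a; have := proj2 (Qcl_psd K') b.
have := proj2 G_psd (P *m a); have := proj2 G_psd (P *m b).
have := proj2 step_le a; have := proj2 step_le b.
have := P0 a; have := P0 b; rewrite -!/(qf _ _) => p1 p2 r1 r2 g1 g2 q1 q2.
have E0 : 0 <= 2 * al * (qf P a + qf P b) by apply: mulr_ge0; lra.
have Da : Dl *m a = 0 by apply: step_Dl; rewrite qfN in r2 *; rewrite qfN in r1; lra.
have Db : Dl *m b = 0 by apply: step_Dl; rewrite qfN in r1 *; rewrite qfN in r2; lra.
have := hF al be a b (eigpair_congr (step_F Da) (step_F Db) e).
by rewrite ltNge al0.
Qed.

(** [P] is a supersolution for the new gain. On the kernel of its residual [K - gain P] vanishes, so
    the new closed loop acts there as the old one, which is Hurwitz. *)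
Lemma step_stab : hurwitz (F K) -> exists P', gain_stab K' P'.
Proof.
move=> hF; have [[PT _] _ hA] := hP; have hF' := step_hurwitz hF.
have [|P' [PT' rP' hA' _]] := ric_exists hF' (proj1 (Qcl_psd K')) G_psd PT step_le.
  move=> al be a b e ra rb.
  have D0 (v : 'cV[R]_m) : ric (F K') (Q K') G P *m v = 0 -> Dl *m v = 0.
    by move=> rv; apply: step_Dl; rewrite qfN /qf -mulmxA rv mulmx0 mxE oppr0.
  have A0 (v : 'cV[R]_m) : Dl *m v = 0 -> (F K' + G *m P) *m v = (F K + G *m P) *m v.
    by move=> Dv; rewrite !(mulmxDl _ (G *m P)) (step_F Dv).
  have /hurwitzP/(_ al be a b) := hA; apply.
  exact: (eigpair_congr (A0 _ (D0 _ ra)) (A0 _ (D0 _ rb)) e).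
exists P'; split; [exact: (ric_psd hF' (Qcl_psd K') G_psd PT' rP') | exact: rP' | exact: hA'].
Qed.

Lemma step_mono P' : gain_stab K' P' -> psdmx (P - P').
Proof.
move=> [[PT' _] rP' hA']; have [[PT _] _ _] := hP.
exact: (ric_le G_psd PT' PT rP' hA' step_le).
Qed.

End Step.

(** * Continuity and expansion of the game equation *)

Lemma gramR_l1 : exists2 kap, 0 < kap &
  forall Z : 'M[R]_(d, m), l1 Z ^+ 2 <= kap * \tr (Z^T *m Rw *m Z).
Proof.
have [r r0 Rr] := pd_ge hR.
exists (((d * m)%:R ^+ 2 + 1) / r); first by rewrite divr_gt0 // ltr_wpDl ?sqr_ge0.
move=> Z; have t0 : 0 <= \tr (Z^T *m Z) by apply/psd_tr/psd_gram.
have h : r * \tr (Z^T *m Z) <= \tr (Z^T *m Rw *m Z).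
  rewrite -subr_ge0 -mxtraceZ -mxtraceB; apply: psd_tr.
  have -> : Z^T *m Rw *m Z - r *: (Z^T *m Z) = Z^T *m (Rw - r *: 1%:M) *m Z by mxring.
  exact: psd_congr.
have := l1_sqr Z; have := sqr_ge0 ((d * m)%:R : R).
set N := _ ^+ 2 => N0 h1; rewrite mulrAC ler_pdivlMr //; nra.
Qed.

Lemma mcvg_gain (u : nat -> 'M[R]_m) P : mcvg u P -> mcvg (fun k => gain (u k)) (gain P).
Proof. by move=> uP; exact: (mcvgM (mcvg_cst (invmx Rw *m B^T)) uP). Qed.

Lemma mcvg_game (u : nat -> 'M[R]_m) P : mcvg u P -> mcvg (fun k => game (u k)) (game P).
Proof.
move=> uP; apply: mcvgD; last exact: (mcvgM (mcvgM uP (mcvg_cst _)) uP).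
apply: mcvgD (mcvg_cst _); apply: mcvgD.
  exact: (mcvgM (mcvg_cst A^T) uP).
exact: (mcvgM uP (mcvg_cst A)).
Qed.

Lemma gameD P X : P^T = P ->
  game (P + X) = game P + lyap (F (gain P) + G *m P) X
    - X *m (B *m invmx Rw *m B^T - G) *m X.
Proof.
move=> PT; have RT : (invmx Rw)^T = invmx Rw by rewrite trmx_inv (proj1 hR).
have GT := proj1 G_psd.
rewrite /game /gain /lyap; move: (G) GT (invmx Rw) RT => G' GT Ri RT.
by mxexpand; rewrite PT GT RT; mxring.
Qed.

(** Subtracting the equations leaves a Sylvester equation with a different closed loop on each side:
    [sylvester0] needs only one to be Hurwitz and lets the other touch the imaginary axis. *)
Lemma game_sylvester P1 P2 : P1^T = P1 ->
  game P1 = 0 -> game P2 = 0 ->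
  (F (gain P1) + G *m P1)^T *m (P1 - P2) + (P1 - P2) *m (F (gain P2) + G *m P2) = 0.
Proof.
move=> PT g1 g2; have RT : (invmx Rw)^T = invmx Rw by rewrite trmx_inv (proj1 hR).
have GT := proj1 G_psd.
rewrite -[RHS](subr0 0) -{1}g1 -g2 /game /gain /lyap.
move: (G) GT (invmx Rw) RT => G' GT Ri RT.
by mxexpand; rewrite PT GT RT; mxring.
Qed.

(** * Convergence of the iterates *)

Section Convergence.
Variables (M : 'M[R]_d) (c : R) (K : nat -> 'M[R]_(d, m)) (P : nat -> 'M[R]_m).
Hypotheses (c0 : 0 < c) (hM : contracting M c).
Hypothesis hP : forall k, gain_stab (K k) (P k).
Hypothesis hK : forall k, K k.+1 = K k - M *m (K k - gain (P k)).
Local Notation Dl k := (K k - gain (P k)).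

Let PT k : (P k)^T = P k. Proof. by case: (hP k) => [[]]. Qed.

Lemma iter_mono k : psdmx (P k - P k.+1).
Proof. by have := hP k.+1; rewrite hK => h; exact: (step_mono c0 hM (hP k) h). Qed.

Lemma iter_cvg : exists2 Pinf, mcvg P Pinf & forall k, psdmx (P k - Pinf).
Proof.
have [N cN hN] : exists2 N, mcvg (fun k => - P k) N & forall k, psdmx (N - - P k).
  apply: (@monotone_mcvg _ _ _ 0) => k; first by rewrite trmx_opp PT.
    by rewrite opprK addrC; exact: iter_mono.
  by rewrite sub0r opprK; case: (hP k).
exists (- N); last by move=> k; have := hN k; rewrite !opprK addrC.
have := mcvgN cN; by under [X in mcvg X]eq_fun do rewrite opprK.
Qed.

(** The Lyapunov identity for [P k - P k.+1] bounds [c tr (Dl^T R Dl)], but its closed loop contains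
    [K k.+1], not yet known to be bounded. That loop is [H k - B (1 - M) Dl k] with [H k]
    convergent, and the part linear in [Dl k] is absorbed by completing a square. *)
Lemma iter_Dl0 : mcvg (fun k => Dl k) 0.
Proof.
have [Pinf cP _] := iter_cvg.
have [kap kap0 gl] := gramR_l1.
pose H k := A - B *m gain (P k) + G *m P k.+1.
pose Hinf := A - B *m gain Pinf + G *m Pinf.
have cH : mcvg H Hinf.
  apply: mcvgD; last exact: (mcvgM (mcvg_cst G) (mcvg_shift cP)).
  exact: (mcvgB (mcvg_cst A) (mcvgM (mcvg_cst B) (mcvg_gain cP))).
pose y k := l1 (P k - P k.+1).
have cy : y k @[k --> \oo] --> (0 : R).
  have := mcvg_l1 (mcvgB cP (mcvg_shift cP)); rewrite subrr.
  by under eq_fun do rewrite subr0.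
pose z := l1 (B *m (1%:M - M)).
(* What remains as a bound on the square of [l1 (Dl k)] after that absorption. *)
pose f k := (l1 (H k - Hinf) + l1 Hinf) * y k * (4 / c * kap)
  + y k * y k * ((2 * kap / c * z) ^+ 2).
have cf : f k @[k --> \oo] --> (0 : R).
  have -> : 0 = (0 + l1 Hinf) * 0 * (4 / c * kap) + 0 * 0 * ((2 * kap / c * z) ^+ 2) :> R.
    by rewrite !mulr0 !mul0r addr0.
  apply: cvgD; apply: cvgMl; apply: cvgM => //.
  by apply: cvgD; [exact: mcvg_l1 | exact: cvg_cst].
suff le k : l1 (Dl k) ^+ 2 <= f k.
  move=> i j; rewrite mxE; apply/cvgrPdist_le => e e0.
  move/cvgrPdist_le/(_ _ (exprn_gt0 2 e0)): cf; apply: filterS => k fk.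
  rewrite sub0r normrN; apply: (le_trans (l1_entry _ _ _)).
  rewrite -(ler_pXn2r (ltn0Sn 1)) ?nnegrE ?l1_ge0 ?(ltW e0) //.
  apply: (le_trans (le k)); apply: le_trans fk.
  by rewrite sub0r normrN ler_norm.
have [_ rP' hA'] := hP k.+1; have [[PkT _] rP _] := hP k.
have Lk : lyap (F (K k.+1) + G *m P k.+1) (P k - P k.+1)
    = lyap (H k) (P k - P k.+1) - lyap (B *m (1%:M - M) *m Dl k) (P k - P k.+1).
  have -> : F (K k.+1) + G *m P k.+1 = H k - B *m (1%:M - M) *m Dl k.
    by rewrite hK /H; move: (gain (P k)) => L; mxring.
  by rewrite lyapBl.
have key : c * \tr ((Dl k)^T *m Rw *m Dl k)
    <= - \tr (lyap (F (K k.+1) + G *m P k.+1) (P k - P k.+1)).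
  rewrite -subr_ge0 -mxtraceN -mxtraceZ -mxtraceB; apply: psd_tr.
  rewrite (lyap_ricB _ (Q (K k.+1)) _ (PT k.+1) (proj1 G_psd)) rP' subr0 opprB addrAC addrC.
  rewrite addrCA; apply: psdD; last by rewrite hK; exact: (ric_step_le hM (hP k)).
  rewrite -{1}(_ : (P k - P k.+1)^T = P k - P k.+1); first exact/psd_congr/G_psd.
  by rewrite trmx_add trmx_opp !PT.
rewrite Lk mxtraceB opprB in key.
have := mxtrace_lyap_le (H k) (P k - P k.+1).
have := mxtrace_lyap_le (B *m (1%:M - M) *m Dl k) (P k - P k.+1).
have := l1M (B *m (1%:M - M)) (Dl k); rewrite -/z -/(y k).
have Hle : l1 (H k) <= l1 (H k - Hinf) + l1 Hinf by rewrite -{1}(subrK Hinf (H k)) l1D.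
have := gl (Dl k).
rewrite /f; move: Hle key.
have y0 : 0 <= y k := l1_ge0 _; have x0 : 0 <= l1 (Dl k) := l1_ge0 _.
move: y0 x0; move: (\tr (lyap (H k) _)) (\tr (lyap (_ *m Dl k) _)) => T1 T2.
move: (\tr (_ *m Dl k)) (l1 (Dl k)) (l1 (_ *m Dl k)) (l1 (H k)) (y k) (l1 (H k - _) + _).
move=> t x bx h yk hb y0 x0 hle key gk bxz n2 n1.
have z0 : 0 <= z := l1_ge0 _.
have q0 : 0 < kap / c by rewrite divr_gt0.
rewrite (_ : 4 / c * kap = 4 * (kap / c)); last by rewrite mulrAC -mulrA.
rewrite (_ : 2 * kap / c * z = 2 * (kap / c) * z); last by rewrite !mulrA.
have kE : kap = kap / c * c by rewrite divfK // gt_eqF.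
move: kE q0; move: (kap / c) => q kE q0.
move: n1 n2; rewrite !ler_norml => /andP[n1 _] /andP[_ n2].
have hy : h * yk <= hb * yk by rewrite ler_wpM2r.
have bxy : bx * yk <= z * x * yk by rewrite ler_wpM2r.
have h1 : c * t <= 2 * (hb * yk) + 2 * (z * x * yk) by lra.
have h2 : x ^+ 2 <= q * (2 * (hb * yk) + 2 * (z * x * yk)).
  apply: (le_trans gk); rewrite kE -mulrA ler_pM2l //.
have := sqr_ge0 (x - 2 * q * z * yk); lra.
Qed.

Variables (Kst : 'M[R]_(d, m)) (Pst : 'M[R]_m).
Hypotheses (hst : gain_stab Kst Pst) (hKst : Kst = gain Pst).

Lemma game_st : game Pst = 0.
Proof. by rewrite (game_stab hst) hKst subrr mulmx0 oppr0. Qed.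

Lemma iter_lim_game Pinf : mcvg P Pinf -> game Pinf = 0.
Proof.
move=> cP; apply: (mcvg_unique (mcvg_game cP)).
have -> : (fun k => game (P k)) = (fun k => - ((Dl k)^T *m Rw *m Dl k)).
  by apply/funext => j; exact (game_stab (hP j)).
have := mcvgN (mcvgM (mcvgM (mcvg_tr iter_Dl0) (mcvg_cst Rw)) iter_Dl0).
by rewrite mulmx0 oppr0.
Qed.

(* The spectrum of the limit closed loop lies in the closed left half plane:
   an eigenvector [v] with eigenvalue of positive real part would satisfy
   [P k v = Pinf v] and [K k v = gain Pinf v] as soon as [P k] is close to
   [Pinf], contradicting the stability of the [k]-th closed loop. *)
Lemma iter_lim_semistable Pinf : mcvg P Pinf -> (forall k, psdmx (P k - Pinf)) ->
  forall al be a b, eigpair (F (gain Pinf) + G *m Pinf) al be a b -> al <= 0.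
Proof.
move=> cP leP al be a b e; rewrite leNgt; apply/negP => al0.
have PiT : Pinf^T = Pinf by exact: (mcvg_sym cP PT).
pose S := B *m invmx Rw *m B^T.
have lS := l1_ge0 S.
have eps0 : 0 < al / (l1 S + 1) by rewrite divr_gt0 //; lra.
have [k /(_ k (leqnn k)) lk] := mcvg_near cP eps0.
have [X XE] : exists X, X = P k - Pinf by exists (P k - Pinf).
have := leP k; rewrite -XE in lk * => Xp; have [XT X0] := Xp.
have PE : P k = Pinf + X by rewrite XE addrC subrK.
have gi := iter_lim_game cP.
have LX : lyap (F (gain Pinf) + G *m Pinf) X
    = X *m S *m X - (Dl k)^T *m Rw *m Dl k - X *m G *m X.
  have := game_stab (hP k); rewrite PE gameD // gi add0r -PE => /eqP.
  rewrite subr_eq addrC -/S => /eqP ->; rewrite (mulmxBr X) (mulmxBl _ _ X).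
  by move: (Dl k) => L; mxring.
have := lyap_eigpair XT e; rewrite -/(lyap _ _) LX.
rewrite !(qfB (_ - _^T *m _ *m _)) !(qfB (_ *m S *m _)) !qf_conj_sym // => E.
have bound (v : 'cV[R]_m) : qf S (X *m v) <= al * qf X v.
  have trX : l1 S * \tr X <= al.
    have : \tr X <= al / (l1 S + 1).
      by apply: le_trans (ler_norm _) (le_trans (l1_mxtrace _) _).
    rewrite ler_pdivlMr; last by lra.
    by have := psd_tr Xp; nra.
  apply: le_trans (ler_norm _) (le_trans (qf_l1 _ _) _).
  apply: (@le_trans _ _ (l1 S * (\tr X * qf X v))).
    by rewrite ler_wpM2l ?l1_ge0 // psd_mul_sqr.
  by rewrite mulrA ler_wpM2r //; exact: X0.
have ba := bound a; have bb := bound b.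
have xa := X0 a; have xb := X0 b; rewrite -!/(qf _ _) in xa xb.
have ga := proj2 G_psd (X *m a); have gb := proj2 G_psd (X *m b).
have da := proj2 (psd_gramR (Dl k)) a; have db := proj2 (psd_gramR (Dl k)) b.
rewrite -!/(qf _ _) in ga gb da db.
have qa' := mulr_ge0 (ltW al0) xa; have qb' := mulr_ge0 (ltW al0) xb.
have za : al * qf X a = 0 by lra.
have zb : al * qf X b = 0 by lra.
have wa : qf ((Dl k)^T *m Rw *m Dl k) a = 0 by lra.
have wb : qf ((Dl k)^T *m Rw *m Dl k) b = 0 by lra.
have AE (v : 'cV[R]_m) : al * qf X v = 0 -> qf ((Dl k)^T *m Rw *m Dl k) v = 0 ->
    (F (gain Pinf) + G *m Pinf) *m v = (F (K k) + G *m P k) *m v.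
  move=> /eqP; rewrite mulf_eq0 gt_eqF //= => /eqP /(psd_qf0 Xp) Xv /qf_gramR0 Dv.
  have Pv : P k *m v = Pinf *m v by rewrite PE mulmxDl Xv addr0.
  have Kv : K k *m v = gain Pinf *m v.
    by rewrite -{1}(subrK (gain (P k)) (K k)) mulmxDl Dv add0r /gain -!mulmxA Pv.
  rewrite !(mulmxDl _ (G *m _)) !(mulmxDl A) !mulNmx -!(mulmxA B) Kv.
  by rewrite -(mulmxA (G) (P k)) Pv (mulmxA (G)).
have [_ _ /hurwitzP/(_ al be a b)] := hP k.
by rewrite ltNge ltW // => /(_ (eigpair_congr (AE a za wa) (AE b zb wb) e)).
Qed.

Lemma iter_lim : mcvg P Pst /\ forall k, psdmx (P k - Pst).
Proof.
have [Pinf cP leP] := iter_cvg.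
have PiT : Pinf^T = Pinf by exact: (mcvg_sym cP PT).
have gi := iter_lim_game cP.
have [_ _ hA] := hst; rewrite hKst in hA.
have := sylvester0 (iter_lim_semistable cP leP) hA (game_sylvester PiT gi game_st).
by move=> /eqP; rewrite subr_eq0 => /eqP <-.
Qed.

Lemma iter_lim_gain : mcvg K Kst.
Proof.
have [cP _] := iter_lim.
have := mcvgD iter_Dl0 (mcvg_gain cP); rewrite add0r -hKst.
by have -> : (fun k => Dl k + gain (P k)) = K by apply/funext => k; rewrite subrK.
Qed.

(** * Local rates for the cost gap *)

Local Notation Ast := (F (gain Pst) + G *m Pst).
Local Notation gap k := (\tr ((P k - Pst) *m (D *m D^T))).

Lemma psd_gap k : psdmx (P k - Pst).
Proof. by case: iter_lim. Qed.

Lemma gap_ge0 k : 0 <= gap k.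
Proof. by apply: psd_mxtrace_mul; [exact: psd_gap | exact: pd_psd]. Qed.

(** [D D^T] dominates a positive multiple of the identity, so the gap controls the whole matrix and
    quadratic terms are bounded by its square. *)
Lemma l1_gap : exists2 C0, 0 <= C0 &
  forall X, psdmx X -> l1 X <= C0 * \tr (X *m (D *m D^T)).
Proof.
have [dl dl0 hdl] := pd_ge hDD.
exists ((m * m)%:R / dl); first by rewrite divr_ge0 // ltW.
move=> X Xp; apply: (le_trans (psd_l1 Xp)); rewrite -mulrA ler_wpM2l //.
rewrite mulrC ler_pdivlMr // mulrC -subr_ge0 -mxtraceZ -mxtraceB.
have -> : X *m (D *m D^T) - dl *: X = X *m (D *m D^T - dl *: 1%:M) by mxring.
exact: psd_mxtrace_mul.
Qed.

(* Pairing with [Sg] turns Lyapunov (in)equations for the differences of Riccati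
   solutions into estimates on the cost gap. *)
Lemma dual_weight : exists2 Sg, psdmx Sg &
  forall X, \tr (Sg *m lyap Ast X) = - \tr (X *m (D *m D^T)).
Proof.
have [_ _ hA] := hst; rewrite hKst in hA; have hAT := hurwitz_trmx hA.
have DT : (- (D *m D^T))^T = - (D *m D^T) by rewrite trmx_opp (proj1 hDD).
have [Sg ST SL] := lyap_surj_sym hAT DT.
exists Sg; first by apply: (lyap_pos hAT ST); rewrite SL opprK; exact: pd_psd.
by move=> X; rewrite mxtrace_lyap_dual SL mulmxN mxtraceN.
Qed.

(** [theta] is spent on splitting the new gain error, [tau] on absorbing into the new gap the terms
    where [X'] meets a factor tending to 0. *)
Lemma iter_rate theta tau : c <= 1 -> 0 < theta -> 0 < tau ->
  exists (k0 : nat) (C0 : R), 0 <= C0 /\ forall k, (k0 <= k)%N ->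
    (1 - tau) * gap k.+1 <= (1 + theta) * (1 - c) * gap k + C0 * gap k ^+ 2.
Proof.
move=> c1 th0 tau0; have [cP _] := iter_lim.
have [C0 C00 hC0] := l1_gap; have [Sg Sgp hSg] := dual_weight.
have PsT : Pst^T = Pst by case: hst => -[].
have [_ rst _] := hst.
pose S := B *m invmx Rw *m B^T.
have s0 := l1_ge0 Sg; have lS := l1_ge0 S; have lG := l1_ge0 G; have lB := l1_ge0 B.
have lSG := l1_ge0 (S - G).
(* Once [l1 X'] and [l1 kap] are below [g], the two error terms add up to at most [tau / 2] times
   [e']. *)
pose g := tau / 2 / (l1 Sg * C0 * l1 G + 2 * l1 Sg * C0 * l1 B + 1).
have den0 : 0 < l1 Sg * C0 * l1 G + 2 * l1 Sg * C0 * l1 B + 1.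
  by rewrite ltr_wpDl // addr_ge0 // ?mulr_ge0.
have g0 : 0 < g by rewrite divr_gt0 // divr_gt0.
have [k1 hk1] := mcvg_near (mcvg_shift cP) g0.
have [k2 hk2] := mcvg_near (mcvg_shift iter_lim_gain) g0.
exists (maxn k1 k2), ((1 + theta) * (1 - c) * (l1 Sg * l1 (S - G) * C0 ^+ 2)
   + (1 + theta^-1) * (l1 Sg * l1 S * C0 ^+ 2)).
have th1 : 0 < theta^-1 by rewrite invr_gt0.
split.
  by rewrite addr_ge0 // !mulr_ge0 // ?subr_ge0 ?addr_ge0 ?sqr_ge0 //; lra.
move=> k; rewrite geq_max => /andP[/hk1 lX' /hk2 lkap].
have := psd_gap k.+1; have := psd_gap k.
have [X XE] : exists X, X = P k - Pst by exists (P k - Pst).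
have [X' X'E] : exists X', X' = P k.+1 - Pst by exists (P k.+1 - Pst).
have [kap kapE] : exists kap, kap = K k.+1 - Kst by exists (K k.+1 - Kst).
rewrite -X'E -XE -kapE in lX' lkap *; move=> Xp X'p.
have [XT _] := Xp; have [X'T _] := X'p.
have [e eE] : exists e, e = \tr (X *m (D *m D^T)) by eexists.
have [e' e'E] : exists e', e' = \tr (X' *m (D *m D^T)) by eexists.
have e0 : 0 <= e by rewrite eE; apply: psd_mxtrace_mul => //; exact: pd_psd.
have e'0 : 0 <= e' by rewrite e'E; apply: psd_mxtrace_mul => //; exact: pd_psd.
have lXe : l1 X <= C0 * e by rewrite eE hC0.
have lX'e : l1 X' <= C0 * e' by rewrite e'E hC0.
rewrite -eE -e'E.
have L' : lyap Ast X' = lyap (B *m kap) X' - kap^T *m Rw *m kap - X' *m G *m X'.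
  have PE : P k.+1 = Pst + X' by rewrite X'E addrC subrK.
  have [_ rP _] := hP k.+1; move: rP.
  rewrite PE ricD //; last exact: (proj1 G_psd).
  rewrite ric_gameE // game_st add0r -{1 2}hKst -kapE.
  have -> : F (K k.+1) + G *m Pst = Ast - B *m kap by rewrite kapE hKst; mxring.
  rewrite lyapBl => h; apply/eqP; rewrite -subr_eq0 -[X in _ == X]h; apply/eqP.
  by move: (lyap Ast X') (lyap (B *m kap) X') => Y1 Y2; mxring.
have E1 : e' = \tr (Sg *m (kap^T *m Rw *m kap)) + \tr (Sg *m (X' *m G *m X'))
    - \tr (Sg *m lyap (B *m kap) X').
  apply: oppr_inj; rewrite e'E -hSg L' !mulmxBr !mxtraceB; ring.
have L : lyap Ast X = X *m (S - G) *m X - (Dl k)^T *m Rw *m Dl k.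
  have PE : P k = Pst + X by rewrite XE addrC subrK.
  have := game_stab (hP k); rewrite PE gameD // game_st add0r -PE => /eqP.
  by rewrite subr_eq => /eqP ->; rewrite addrC.
have E2 : \tr (Sg *m ((Dl k)^T *m Rw *m Dl k)) = e + \tr (Sg *m (X *m (S - G) *m X)).
  by apply/eqP; rewrite -subr_eq -mxtraceB -mulmxBr -opprB -L mulmxN mxtraceN hSg opprK eE.
(* The new gain error is [p + q]: [p] is contracted, and [q] contributes only [X S X], quadratic in
   the gap. *)
pose p := (1%:M - M) *m Dl k; pose q := gain X.
have kapD : kap = p + q.
  by rewrite kapE hK hKst /p /q /gain XE; mxring.
(* Weighted Young inequality: the difference is [theta] times the Gram form of [p - q / theta]. *)
have E3 : \tr (Sg *m (kap^T *m Rw *m kap)) <= (1 + theta) * \tr (Sg *m (p^T *m Rw *m p))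
    + (1 + theta^-1) * \tr (Sg *m (q^T *m Rw *m q)).
  rewrite -subr_ge0 -!mxtraceZ -raddfD /= -mxtraceB.
  have -> : (1 + theta) *: (Sg *m (p^T *m Rw *m p)) + (1 + theta^-1) *: (Sg *m (q^T *m Rw *m q))
     - Sg *m (kap^T *m Rw *m kap)
    = Sg *m (theta *: ((p - theta^-1 *: q)^T *m Rw *m (p - theta^-1 *: q))).
    rewrite kapD; move: p q {kapD} => p q.
    mxexpand; apply/matrixP => ? ?; rewrite ?(addmxE, oppmxE, scalemxE); field.
    by rewrite gt_eqF.
  by apply: psd_mxtrace_mul => //; apply: psdZ; [exact: ltW | exact: psd_gramR].
have E4 : \tr (Sg *m (p^T *m Rw *m p)) <= (1 - c) * \tr (Sg *m ((Dl k)^T *m Rw *m Dl k)).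
  rewrite -subr_ge0 -mxtraceZ -mxtraceB.
  have -> : (1 - c) *: (Sg *m ((Dl k)^T *m Rw *m Dl k)) - Sg *m (p^T *m Rw *m p)
    = Sg *m ((Dl k)^T *m ((1 - c) *: Rw - (1%:M - M)^T *m Rw *m (1%:M - M)) *m Dl k).
    by rewrite /p; move: (Dl k) => W; mxring.
  by apply: psd_mxtrace_mul => //; exact: psd_congr.
have E5 : q^T *m Rw *m q = X *m S *m X by rewrite /q gain_quad.
have lXe2 : l1 X ^+ 2 <= C0 ^+ 2 * e ^+ 2.
  by rewrite -exprMn ler_sqr ?nnegrE ?l1_ge0 // mulr_ge0.
have b1 := mxtrace_quad_l1 Sg X (S - G).
have b2 := mxtrace_quad_l1 Sg X S.
have b3 := mxtrace_quad_l1 Sg X' G.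
have b4 : `|\tr (Sg *m lyap (B *m kap) X')| <= l1 Sg * (2 * (l1 B * l1 kap * l1 X')).
  apply: (le_trans (l1_mxtrace _)); apply: (le_trans (l1M _ _)); rewrite ler_wpM2l //.
  apply: (le_trans (l1D _ _)).
  have h1 := l1M B kap; have h2 := l1M (B *m kap)^T X'; have h3 := l1M X' (B *m kap).
  rewrite l1_tr in h2; have := l1_ge0 X'; nra.
rewrite E5 in E3.
have gE : g * (l1 Sg * C0 * l1 G + 2 * l1 Sg * C0 * l1 B) <= tau / 2.
  have <- : g * (l1 Sg * C0 * l1 G + 2 * l1 Sg * C0 * l1 B + 1) = tau / 2.
    by rewrite /g divfK // gt_eqF.
  by rewrite ler_pM2l // lerDl.
have X'0 := l1_ge0 X'; have kap0 := l1_ge0 kap.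
have t3 : \tr (Sg *m (X' *m G *m X')) <= g * (l1 Sg * C0 * l1 G) * e'.
  apply: (le_trans (ler_norm _)); apply: (le_trans b3).
  have -> : g * (l1 Sg * C0 * l1 G) * e' = l1 Sg * l1 G * (g * (C0 * e')) by ring.
  by rewrite ler_wpM2l ?mulr_ge0 // expr2 ler_pM.
have t4 : - \tr (Sg *m lyap (B *m kap) X') <= g * (2 * l1 Sg * C0 * l1 B) * e'.
  apply: (le_trans (ler_norm _)); rewrite normrN; apply: (le_trans b4).
  have -> : g * (2 * l1 Sg * C0 * l1 B) * e' = l1 Sg * (2 * (l1 B * (g * (C0 * e')))) by ring.
  by rewrite ler_wpM2l // ler_pM2l // -mulrA ler_wpM2l // ler_pM.
have t34 : g * (l1 Sg * C0 * l1 G) * e' + g * (2 * l1 Sg * C0 * l1 B) * e' <= tau * e'.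
  rewrite -mulrDl -mulrDr ler_wpM2r //; lra.
have t1 : \tr (Sg *m (X *m (S - G) *m X)) <= l1 Sg * l1 (S - G) * C0 ^+ 2 * e ^+ 2.
  apply: (le_trans (ler_norm _)); apply: (le_trans b1).
  by rewrite -[leRHS]mulrA ler_wpM2l // mulr_ge0.
have t2 : \tr (Sg *m (X *m S *m X)) <= l1 Sg * l1 S * C0 ^+ 2 * e ^+ 2.
  apply: (le_trans (ler_norm _)); apply: (le_trans b2).
  by rewrite -[leRHS]mulrA ler_wpM2l // mulr_ge0.
have u1 : (1 + theta) * \tr (Sg *m (p^T *m Rw *m p))
    <= (1 + theta) * ((1 - c) * (e + l1 Sg * l1 (S - G) * C0 ^+ 2 * e ^+ 2)).
  rewrite ler_pM2l; last by lra.
  apply: (le_trans E4); rewrite E2 ler_wpM2l ?subr_ge0 // lerD2l; exact: t1.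
have u2 : (1 + theta^-1) * \tr (Sg *m (X *m S *m X))
    <= (1 + theta^-1) * (l1 Sg * l1 S * C0 ^+ 2 * e ^+ 2).
  by rewrite ler_pM2l //; lra.
have -> : (1 + theta) * (1 - c) * e +
   ((1 + theta) * (1 - c) * (l1 Sg * l1 (S - G) * C0 ^+ 2) +
    (1 + theta^-1) * (l1 Sg * l1 S * C0 ^+ 2)) * e ^+ 2
  = (1 + theta) * ((1 - c) * (e + l1 Sg * l1 (S - G) * C0 ^+ 2 * e ^+ 2))
    + (1 + theta^-1) * (l1 Sg * l1 S * C0 ^+ 2 * e ^+ 2) by ring.
clear - E1 E3 u1 u2 t3 t4 t34; lra.
Qed.

Lemma gap_cvg : gap k @[k --> \oo] --> (0 : R).
Proof.
have [cP _] := iter_lim.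
have := mcvg_mxtrace (mcvgM (mcvgB cP (mcvg_cst Pst)) (mcvg_cst (D *m D^T))).
by rewrite subrr mul0mx mxtrace0.
Qed.

(** Take [theta = c / 2], [tau = c / 8] and a gap [e] with [C0 e^2 <= c e / 8]. As
    [(1 + c / 2) (1 - c) <= 1 - c / 2], the rate is [(1 - 3 c / 8) / (1 - c / 8)]. *)
Lemma gap_linear : c <= 1 -> exists (k0 : nat) (rho : R), 0 < rho < 1 /\
  forall k, (k0 <= k)%N -> gap k.+1 <= rho * gap k.
Proof.
move=> c1; have [k1 [C0 [C00 h]]] : exists (k0 : nat) (C0 : R), 0 <= C0 /\
    forall k, (k0 <= k)%N -> (1 - c / 8) * gap k.+1
      <= (1 + c / 2) * (1 - c) * gap k + C0 * gap k ^+ 2.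
  by apply: iter_rate => //; rewrite divr_gt0.
have e0 : 0 < c / 8 / (C0 + 1) by rewrite divr_gt0 ?divr_gt0 //; lra.
move/cvgrPdist_le/(_ _ e0): gap_cvg => [k2 _ h2].
have d0 : 0 < 8 - c by lra.
exists (maxn k1 k2), ((8 - 3 * c) / (8 - c)); split.
  apply/andP; split; [apply: divr_gt0; lra |].
  by rewrite ltr_pdivrMr // mul1r ltrD2l ltrN2 ltr_pMl //; lra.
move=> k; rewrite geq_max => /andP[/h hk /h2] /=.
have := gap_ge0 k; move: hk; move: (gap k.+1) (gap k) => e' e hk ge.
rewrite sub0r normrN ger0_norm // ler_pdivlMr; last by lra.
move=> le; rewrite mulrAC ler_pdivlMr //.
have h3 : C0 * e ^+ 2 <= c / 8 * e.
  by rewrite expr2 mulrA ler_wpM2r // mulrC; lra.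
have h4 : (1 + c / 2) * (1 - c) * e <= (1 - c / 2) * e.
  by rewrite ler_wpM2r //; nra.
lra.
Qed.

Lemma gap_quadratic : c = 1 -> exists (k0 : nat) (C0 : R), 0 < C0 /\
  forall k, (k0 <= k)%N -> gap k.+1 <= C0 * gap k ^+ 2.
Proof.
move=> cE; have [k1 [C0 [C00 h]]] : exists (k0 : nat) (C0 : R), 0 <= C0 /\
    forall k, (k0 <= k)%N -> (1 - 1 / 2) * gap k.+1
      <= (1 + 1) * (1 - c) * gap k + C0 * gap k ^+ 2.
  by apply: iter_rate; rewrite ?cE ?divr_gt0.
(* The choice [tau = 1 / 2] doubles the constant; adding 1 makes it positive. *)
exists k1, (2 * C0 + 1); split; first by lra.
move=> k /h; rewrite cE subrr mulr0 mul0r add0r => hk.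
by have := sqr_ge0 (gap k); lra.
Qed.

End Convergence.

(** * From Riccati solutions to feasibility and costs *)

Lemma riccP K : (exists P, gain_stab K P) -> gain_stab K (ricc A B C D Rw gamma K).
Proof.
move=> [P /stabilizing_solutionE hP]; apply/stabilizing_solutionE.
by apply: (@xgetPex _ 0 [set P | stabilizing_solution A B C D Rw gamma K P]); exists P.
Qed.

Lemma costE K : cost A B C D Rw gamma K = \tr (ricc A B C D Rw gamma K *m (D *m D^T)).
Proof. by rewrite /cost mulmxA. Qed.

Section Descent.
Variables (M : 'M[R]_d) (c : R) (K : nat -> 'M[R]_(d, m)) (Kst : 'M[R]_(d, m)).
Hypotheses (c0 : 0 < c) (c1 : c <= 1) (hM : contracting M c).
Hypothesis hst : feasible A B C D Rw gamma Kst.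
Hypothesis hform : Kst = gain (ricc A B C D Rw gamma Kst).
Hypothesis hK0 : feasible A B C D Rw gamma (K 0%N).
Local Notation Pr K := (ricc A B C D Rw gamma K).
Local Notation J K := (cost A B C D Rw gamma K).
Hypothesis hK : forall k, K k.+1 = K k - M *m (K k - gain (Pr (K k))).

(** Stability of [A - B K] is carried along, since each step uses it besides the Riccati
    solution. *)
Lemma descent_stab k : hurwitz (F (K k)) /\ gain_stab (K k) (Pr (K k)).
Proof.
elim: k => [|k [hF hP]]; first by split; [case: hK0 | exact/riccP/feasible_stab].
rewrite hK; split; first exact: (step_hurwitz c0 hM hP hF).
by apply: riccP; exact: (step_stab c0 hM hP hF).
Qed.

Lemma descent_feasible k : feasible A B C D Rw gamma (K k).
Proof. by have [hF hP] := descent_stab k; exact: (stab_feasible hF hP). Qed.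

Let stP : gain_stab Kst (Pr Kst). Proof. exact/riccP/feasible_stab. Qed.
Let hP k : gain_stab (K k) (Pr (K k)). Proof. by case: (descent_stab k). Qed.

Lemma costB k : J (K k) - J Kst = \tr ((Pr (K k) - Pr Kst) *m (D *m D^T)).
Proof. by rewrite !costE mulmxBl mxtraceB. Qed.

Lemma descent_cvg : K k @[k --> \oo] --> Kst.
Proof. exact: (mcvg_topology (iter_lim_gain c0 hM hP hK stP hform)). Qed.

Lemma descent_cost_cvg : J (K k) @[k --> \oo] --> J Kst.
Proof.
have [cP _] := iter_lim c0 hM hP hK stP hform.
exact: (mcvg_mxtrace (mcvgM (mcvgM cP (mcvg_cst D)) (mcvg_cst D^T))).
Qed.

Lemma descent_linear : exists (k0 : nat) (rho : R), 0 < rho < 1 /\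
  forall k, (k0 <= k)%N -> J (K k.+1) - J Kst <= rho * (J (K k) - J Kst).
Proof.
have [k0 [rho [h1 h2]]] := gap_linear c0 hM hP hK stP hform c1.
exists k0, rho; split; first exact: h1.
move=> k hk; exact (le_congr (g := fun x => rho * x) (costB k.+1) (costB k) (h2 k hk)).
Qed.

Lemma descent_quadratic : c = 1 -> exists (k0 : nat) (C0 : R), 0 < C0 /\
  forall k, (k0 <= k)%N -> J (K k.+1) - J Kst <= C0 * (J (K k) - J Kst) ^+ 2.
Proof.
move=> cE; have [k0 [C0 [h1 h2]]] := gap_quadratic c0 hM hP hK stP hform cE.
exists k0, C0; split; first exact: h1.
move=> k hk; exact (le_congr (g := fun x => C0 * x ^+ 2) (costB k.+1) (costB k) (h2 k hk)).
Qed.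

End Descent.

(** * Contraction property of the two updates *)

Lemma contracting_scalar eta : contracting ((2 * eta) *: 1%:M) (4 * eta * (1 - eta)).
Proof.
rewrite /contracting.
(* Equality holds, as [(1 - 2 eta)^2 = 1 - 4 eta (1 - eta)]. *)
have -> : (1 - 4 * eta * (1 - eta)) *: Rw
    - (1%:M - (2 * eta) *: 1%:M)^T *m Rw *m (1%:M - (2 * eta) *: 1%:M) = 0 by mxring.
exact: psd0.
Qed.

(** In powers of the weight, [R - 4 eta R^2 + 4 eta^2 R^3 <= R - 2 eta R^2] since [2 eta R <= I],
    and [R^2 >= r R]. *)
Lemma contracting_weight eta r : 0 < eta ->
  (forall v, 2 * eta * qf Rw v <= qf 1%:M v) ->
  psdmx (Rw - r *: 1%:M) -> 0 < r ->
  contracting ((2 * eta) *: Rw) (Num.min (2 * eta * r) 1).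
Proof.
move=> e0 hop hr r0; set c := Num.min _ _.
have c2 : c <= 2 * eta * r by rewrite ge_min lexx.
have RT := proj1 hR.
have rT : (1%:M - (2 * eta) *: Rw)^T = 1%:M - (2 * eta) *: Rw.
  by rewrite trmx_add trmx_opp trmx_scale trmx1 RT.
split.
  have := proj1 (psd_gramR (1%:M - (2 * eta) *: Rw)); set T := _ *m _ => TT.
  by rewrite trmx_add trmx_scale RT trmx_opp TT.
move=> v; rewrite -/(qf _ _) qfB qfZ qf_congr mulmxBl mul1mx -scalemxAl.
rewrite !qfE !(bfDl, bfDr, bfNl, bfNr, bfZl, bfZr) -!qfE.
set u := Rw *m v; set x := qf Rw v.
have b1 : bf Rw v u = qf 1%:M u by rewrite -{1}RT -[Rw^T]mulmx1 bf_mull.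
have b2 : bf Rw u v = qf 1%:M u by rewrite (bf_sym u v RT).
rewrite b1 b2; set y := qf 1%:M u; set w := qf Rw u.
have hw := hop u; rewrite -/w -/y in hw.
have x0 : 0 <= x := proj2 (pd_psd hR) v.
(* This is [R^2 >= r R] at [v]: Cauchy-Schwarz gives [x^2 <= |v|^2 y], and [r |v|^2 <= x]. *)
have rx : r * x <= y.
  have h1 := proj2 hr v; rewrite -/(qf _ _) qfB qfZ subr_ge0 -/x in h1.
  have := psd_cauchy v u (psd1 R d); rewrite -/y.
  have -> : bf 1%:M v u = x by rewrite -bf_mulr mul1mx.
  have y0 : 0 <= y := qf1_ge0 _.
  have v0 := qf1_ge0 v; move: h1 v0; move: (qf 1%:M v) => z h1 z0 h2.
  have [->|xn] := eqVneq x 0; first by rewrite mulr0.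
  have xp : 0 < x by rewrite lt_neqAle eq_sym xn.
  rewrite -(ler_pM2r xp); apply: (@le_trans _ _ (r * (z * y))).
    by rewrite -mulrA ler_pM2l // -expr2.
  by rewrite mulrA [leRHS]mulrC ler_wpM2r.
have cx : c * x <= 2 * eta * y.
  apply: (@le_trans _ _ (2 * eta * r * x)); first by rewrite ler_wpM2r.
  by rewrite -mulrA ler_pM2l // mulr_gt0.
have ew : 2 * eta * (2 * eta * w) <= 2 * eta * y by rewrite ler_pM2l // mulr_gt0.
lra.
Qed.

End ClosedLoop.

(** * Application to the natural gradient and Gauss-Newton iterations *)

Theorem theoremA8 (R : realType) (m d l n : nat)
    (A : 'M[R]_m) (B : 'M[R]_(m, d)) (C : 'M[R]_(l, m)) (D : 'M[R]_(m, n))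
    (E : 'M[R]_(l, d)) (Rw : 'M[R]_d) (gamma eta : R)
    (Kst : 'M[R]_(d, m)) (K : nat -> 'M[R]_(d, m))
    (hE : E^T *m row_mx C E = row_mx 0 Rw) (hRw : pdmx Rw)
    (hgamma : 0 < gamma)
    (hKst : feasible A B C D Rw gamma Kst)
    (hopt : forall K' : 'M[R]_(d, m), feasible A B C D Rw gamma K' ->
       cost A B C D Rw gamma Kst <= cost A B C D Rw gamma K')
    (hform : Kst = invmx Rw *m B^T *m ricc A B C D Rw gamma Kst)
    (hK0 : feasible A B C D Rw gamma (K 0%N))
    (hK0fin : ((opnorm (K 0%N))%:E < +oo)%E)
    (hdet : detectable A C)
    (hDD : pdmx (D *m D^T))
    (heta : 0 < eta)
    (hiter : (natural_pg_iter A B C D Rw gamma eta K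
                /\ eta <= 1 / (2 * opnorm Rw))
          \/ (gauss_newton_iter A B C D Rw gamma eta K /\ eta <= 1 / 2)) :
  [/\ forall k, feasible A B C D Rw gamma (K k),
      K k @[k --> \oo] --> Kst,
      cost A B C D Rw gamma (K k) @[k --> \oo] --> cost A B C D Rw gamma Kst
    & exists (k0 : nat) (rho : R), 0 < rho < 1 /\
        forall k, (k0 <= k)%N ->
          cost A B C D Rw gamma (K k.+1) - cost A B C D Rw gamma Kst
          <= rho * (cost A B C D Rw gamma (K k) - cost A B C D Rw gamma Kst)]
  /\
  (gauss_newton_iter A B C D Rw gamma eta K -> eta = 1 / 2 ->
     exists (k0 : nat) (c : R), 0 < c /\
       forall k, (k0 <= k)%N ->
         cost A B C D Rw gamma (K k.+1) - cost A B C D Rw gamma Kst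
         <= c * (cost A B C D Rw gamma (K k)
                 - cost A B C D Rw gamma Kst) ^+ 2).
Proof.
have GN : gauss_newton_iter A B C D Rw gamma eta K -> forall k,
    K k.+1 = K k - (2 * eta) *: 1%:M *m (K k - gain B Rw (ricc A B C D Rw gamma (K k))).
  by move=> hGN k; rewrite hGN -scalemxAl mul1mx.
split; last first.
  move=> /GN hK eE; have := contracting_scalar Rw eta.
  have -> : 4 * eta * (1 - eta) = 1 by rewrite eE; field.
  move=> hM; exact: (descent_quadratic hRw hgamma hDD ltr01 hM hKst hform hK0 hK (erefl 1)).
have [M [c [c0 c1 hM hK]]] : exists (M : 'M[R]_d) (c : R), [/\ 0 < c, c <= 1,
    contracting Rw M c & forall k,
    K k.+1 = K k - M *m (K k - gain B Rw (ricc A B C D Rw gamma (K k)))].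
  case: hiter => [[hNPG hle]|[/GN hK hle]]; last first.
    exists ((2 * eta) *: 1%:M), (4 * eta * (1 - eta)); split=> //; first by nra.
      by have := sqr_ge0 (1 - 2 * eta); nra.
    exact: contracting_scalar.
  have [r r0 hr] := pd_ge hRw.
  (* [r] bounds [Rw] from below; the minimum with 1 ensures [c <= 1]. *)
  exists ((2 * eta) *: Rw), (Num.min (2 * eta * r) 1); split.
  - by rewrite lt_min ltr01 andbT !mulr_gt0.
  - by rewrite ge_min lexx orbT.
  - apply: contracting_weight => // v.
    (* The inverse of 0 being 0, a vanishing norm would turn the stepsize bound into [eta <= 0]. *)
    have op0 : 0 < 2 * opnorm Rw.
      by rewrite -invr_gt0; move: hle; rewrite mul1r; exact: lt_le_trans.
    have h : eta * (2 * opnorm Rw) <= 1 by rewrite -ler_pdivlMr.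
    apply: (@le_trans _ _ (2 * eta * (opnorm Rw * qf 1%:M v))).
      by rewrite ler_pM2l ?mulr_gt0 //; exact: qf_opnorm.
    by have := qf1_ge0 v; nra.
  - by move=> k; rewrite hNPG -scalemxAl mulmxBr RgainE.
split.
- exact: (descent_feasible hRw hgamma hDD c0 hM hK0 hK).
- exact: (descent_cvg hRw hgamma hDD c0 hM hKst hform hK0 hK).
- exact: (descent_cost_cvg hRw hgamma hDD c0 hM hKst hform hK0 hK).
- exact: (descent_linear hRw hgamma hDD c0 c1 hM hKst hform hK0 hK).
Qed.
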